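(* Let $q$ be a (real, local or global) solution of the KdV equation $q_t=\frac{1}{4}(q_{xxx}-6qq_x)$ defined near $(0,0)$, and let $E$ be the trivialization of $q$ normalized at $(x,t)=(0,0)$. Given $\xi,k\in\mathbb R$ with $k\ne0$, set $$\begin{pmatrix}f_1(x,t)\\ f_2(x,t)\end{pmatrix}=E(x,t,k)^{-1}\begin{pmatrix}k-\xi\\ 1\end{pmatrix},\qquad\tilde\xi(x,t)=k-\frac{f_1(x,t)}{f_2(x,t)},$$ $$\tilde q(x,t)=-q(x,t)+2(\tilde\xi(x,t)^2-k^2),\qquad\tilde E(x,t,\lambda)=\frac{p_{\xi,k}(\lambda)E(x,t,\lambda)p_{-\tilde\xi(x,t),k}(\lambda)}{\lambda^2-k^2}.$$ If $f_2$ does not vanish in $\mathcal O\subset\mathbb R^2$, then $\tilde q$ is a solution of the KdV equation defined on $\mathcal O$ and $\tilde E(x,t,\lambda)$ is the trivialization of $\tilde q$.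
   Context: The trivialization of a solution $q$ of KdV normalized at $(0,0)$ is the solution $E(x,t,\lambda)$ (holomorphic in $\lambda\in\mathbb C$) of $$E_x=E(a\lambda+u),\qquad E_t=E(a\lambda^3+u\lambda^2+Q_2\lambda+Q_3),\qquad E(0,0,\lambda)=I,$$ where $$a=\begin{pmatrix}1&0\\ 0&-1\end{pmatrix},\quad u=\begin{pmatrix}0&q\\ 1&0\end{pmatrix},\quad Q_2=\begin{pmatrix}-\frac{q}{2}&-\frac{q_x}{2}\\ 0&\frac{q}{2}\end{pmatrix},\quad Q_3=\begin{pmatrix}\frac{q_x}{4}&\frac{q_{xx}-2q^2}{4}\\ -\frac{q}{2}&-\frac{q_x}{4}\end{pmatrix}.$$ For $\xi,k\in\mathbb R$, $p_{\xi,k}(\lambda)=\begin{pmatrix}\lambda+\xi&\xi^2-k^2\\ 1&-\lambda+\xi\end{pmatrix}$. The set $\mathcal O$ is open in the domain of $q$ and contains $(0,0)$. *)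

(* Defs.v *)
From Stdlib Require Export Reals.
From Coquelicot Require Export Coquelicot.
Open Scope R_scope.

Definition Cmx (m n : nat) : Type := @matrix C_Ring m n.

Definition entry {m n : nat} (M : Cmx m n) (i j : nat) : C :=
  coeff_mat (RtoC 0) M i j.

Definition mx2 (m11 m12 m21 m22 : C) : Cmx 2 2 :=
  ((m11, (m12, tt)), ((m21, (m22, tt)), tt)).

Definition cv2 (v1 v2 : C) : Cmx 2 1 := ((v1, tt), ((v2, tt), tt)).

Definition mxadd {m n : nat} (M N : Cmx m n) : Cmx m n := Mplus M N.

Definition mxmul {m n p : nat} (M : Cmx m n) (N : Cmx n p) : Cmx m p :=
  Mmult M N.

Definition mxscal {m n : nat} (c : C) (M : Cmx m n) : Cmx m n :=
  mk_matrix m n (fun i j => (c * entry M i j)%C).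

Definition mxdet2 (M : Cmx 2 2) : C :=
  (entry M 0 0 * entry M 1 1 - entry M 0 1 * entry M 1 0)%C.

(* Adjugate formula; this is the inverse whenever the determinant is nonzero. *)
Definition mxinv2 (M : Cmx 2 2) : Cmx 2 2 :=
  mxscal (/ mxdet2 M)%C
    (mx2 (entry M 1 1) (- entry M 0 1)%C (- entry M 1 0)%C (entry M 0 0)).

Definition mx_is_derive (M : R -> Cmx 2 2) (x : R) (D : Cmx 2 2) : Prop :=
  forall i j : nat, (i < 2)%nat -> (j < 2)%nat ->
    @is_derive R_AbsRing C_R_NormedModule
      (fun z : R => entry (M z) i j) x (entry D i j).

Definition mx_entire (M : C -> Cmx 2 2) : Prop :=
  forall i j : nat, (i < 2)%nat -> (j < 2)%nat -> forall lam : C,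
    @ex_derive C_AbsRing C_NormedModule (fun z : C => entry (M z) i j) lam.

Definition connected_set {T : UniformSpace} (U : T -> Prop) : Prop :=
  forall A B : T -> Prop, open A -> open B ->
    (forall p, U p -> A p \/ B p) ->
    (exists p, U p /\ A p) -> (exists p, U p /\ B p) ->
    exists p, U p /\ A p /\ B p.

(* On an open [U] this is the class C^infinity: [ex_diff_n f n] asks for the
   iterated partial derivatives up to order [n] to exist and be continuous. *)
Definition smooth_on (U : R * R -> Prop) (f : R -> R -> R) : Prop :=
  forall x t : R, U (x, t) -> forall n : nat, ex_diff_n f n x t.

(* [partial_derive m n q] differentiates [m] times in the first variable x and
   [n] times in the second variable t. *)
Definition KdV_solution (U : R * R -> Prop) (q : R -> R -> R) : Prop :=
  smooth_on U q /\
  forall x t : R, U (x, t) ->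
    partial_derive 0 1 q x t =
      / 4 * (partial_derive 3 0 q x t
             - 6 * q x t * partial_derive 1 0 q x t).

Definition mx_a : Cmx 2 2 :=
  mx2 (RtoC 1) (RtoC 0) (RtoC 0) (RtoC (-1)).

Definition mx_u (q : R -> R -> R) (x t : R) : Cmx 2 2 :=
  mx2 (RtoC 0) (RtoC (q x t)) (RtoC 1) (RtoC 0).

Definition mx_Q2 (q : R -> R -> R) (x t : R) : Cmx 2 2 :=
  mx2 (RtoC (- (q x t / 2))) (RtoC (- (partial_derive 1 0 q x t / 2)))
      (RtoC 0)               (RtoC (q x t / 2)).

Definition mx_Q3 (q : R -> R -> R) (x t : R) : Cmx 2 2 :=
  mx2 (RtoC (partial_derive 1 0 q x t / 4))
      (RtoC ((partial_derive 2 0 q x t - 2 * q x t ^ 2) / 4))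
      (RtoC (- (q x t / 2)))
      (RtoC (- (partial_derive 1 0 q x t / 4))).

Definition lax_x (q : R -> R -> R) (x t : R) (lam : C) : Cmx 2 2 :=
  mxadd (mxscal lam mx_a) (mx_u q x t).

Definition lax_t (q : R -> R -> R) (x t : R) (lam : C) : Cmx 2 2 :=
  mxadd (mxadd (mxadd (mxscal (lam * lam * lam)%C mx_a)
                      (mxscal (lam * lam)%C (mx_u q x t)))
               (mxscal lam (mx_Q2 q x t)))
        (mx_Q3 q x t).

(* [E] is a trivialization of [q] on [U] normalized at (0,0); it is unique when
   [U] is open, connected and contains (0,0) and [q] is smooth on [U]. *)
Definition is_trivialization (U : R * R -> Prop) (q : R -> R -> R)
    (E : R -> R -> C -> Cmx 2 2) : Prop :=
  (forall (x t : R) (lam : C), U (x, t) ->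
     mx_is_derive (fun z => E z t lam) x (mxmul (E x t lam) (lax_x q x t lam)) /\
     mx_is_derive (fun s => E x s lam) t (mxmul (E x t lam) (lax_t q x t lam))) /\
  (forall x t : R, U (x, t) -> mx_entire (fun lam => E x t lam)) /\
  (forall lam : C, E 0 0 lam = Mone).

Definition bt_p (xi k : R) (lam : C) : Cmx 2 2 :=
  mx2 (lam + RtoC xi)%C (RtoC (xi ^ 2 - k ^ 2))
      (RtoC 1)          (- lam + RtoC xi)%C.

Definition bt_f (E : R -> R -> C -> Cmx 2 2) (xi k x t : R) : Cmx 2 1 :=
  mxmul (mxinv2 (E x t (RtoC k))) (cv2 (RtoC (k - xi)) (RtoC 1)).

Definition bt_f1 (E : R -> R -> C -> Cmx 2 2) (xi k x t : R) : C :=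
  entry (bt_f E xi k x t) 0 0.

Definition bt_f2 (E : R -> R -> C -> Cmx 2 2) (xi k x t : R) : C :=
  entry (bt_f E xi k x t) 1 0.

Definition bt_q (q xit : R -> R -> R) (k x t : R) : R :=
  - q x t + 2 * (xit x t ^ 2 - k ^ 2).

Definition bt_E (E : R -> R -> C -> Cmx 2 2) (xit : R -> R -> R) (xi k x t : R)
    (lam : C) : Cmx 2 2 :=
  mxscal (/ (lam * lam - RtoC (k ^ 2)))%C
    (mxmul (mxmul (bt_p xi k lam) (E x t lam)) (bt_p (- xit x t) k lam)).

(* Main.v *)
Require Import Defs.
From Stdlib Require Import Lra Lia Classical ClassicalEpsilon.

(** Both equations for [E] act on each row of [E] separately, by trace-free
    matrices, so the Wronskian of two row solutions is constant on the connected
    set [U].  Applied to the rows of [E] this gives [det E = 1], and Cramer's rule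
    then expresses every row solution by the rows of [E]
    ([row_solution_unique]).  Uniqueness turns each symmetry of the equations into
    one of [E]: conjugation makes [E] real at [lam = k], and
    [(y, z) |-> (y, z + 2 lam y)] relates [E] at [lam] to [E] at [- lam].

    Since [det E = 1], the vector [(f_2, - f_1)] is the row [(1, xi - k) E(k)],
    and its quotient satisfies a Riccati equation in [x] and one in [t] whose
    coefficients are polynomials in [q], [q_x], [q_xx].  The Riccati equations
    carry the transformation: they show by induction on the order that the new
    parameter, once continuous, is smooth ([riccati_smooth]), they reduce the KdV equation of the new potential to a
    polynomial identity ([riccati_KdV]), and they say exactly that right
    multiplication by [p_{-xit,k}(lam)] maps row solutions for [q] to row
    solutions for the new potential ([darboux_row]).

    What is left are the points [lam = k] and [lam = - k].  The numerator of the
    transformed trivialization vanishes there: at [k] because the right factor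
    annihilates [(f_2, - f_1)], at [- k] by the symmetry [lam |-> - lam]
    ([num_zero]).  The quotient is holomorphic there if the numerator is twice
    differentiable.  This is read off from the differential equations: the Taylor
    expansion of second order of a row in [lam] has coefficients that solve linear
    equations, and a Gronwall estimate carries the cubic bound for its remainder
    along segments, starting from [E(0, 0, lam) = I] ([jet_propagation]).  The
    first coefficient satisfies the equations differentiated in [lam], which
    gives the equations for the quotient at [lam = k] and [lam = - k]
    ([darboux_dual_row]). *)

Notation rderive := (@is_derive R_AbsRing C_R_NormedModule).
Notation cderive := (@is_derive C_AbsRing C_NormedModule).
Notation ex_cderive := (@ex_derive C_AbsRing C_NormedModule).

(** * Differentiation of complex-valued functions *)

(** The two structures carry different neighbourhood bases, boxes and discs,
    but the same norm, and differentiability only depends on the norm.  The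
    product and chain rules are about functions into the second one. *)
Lemma cderive_abs (f : C -> C) (z l : C) :
  cderive f z l <-> @is_derive C_AbsRing (AbsRing_NormedModule C_AbsRing) f z l.
Proof. split; intros [[H1 H2 H3] H]; (split; [split; assumption | exact H]). Qed.

Lemma cderive_eps (f : C -> C) (z l : C) :
  cderive f z l <->
  forall eps : posreal, exists d : posreal, forall w : C, Cmod (w - z) < d ->
    Cmod (f w - f z - (w - z) * l) <= eps * Cmod (w - z).
Proof.
split.
- intros [_ H] eps.
  destruct (H z (fun P HP => HP) eps) as [d Hd].
  exists d; intros w Hw; apply (Hd w Hw).
- intros H; split.
  + apply is_linear_scal_l.
  + intros x Hx.
    apply (is_filter_lim_locally_unique (V := AbsRing_NormedModule C_AbsRing))
      in Hx; subst x.
    intros eps; destruct (H eps) as [d Hd]; now exists d.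
Qed.

Lemma cderive_ext (f g : C -> C) (z l : C) :
  (forall w, f w = g w) -> cderive f z l -> cderive g z l.
Proof. intros H; now apply (is_derive_ext (V := C_NormedModule)). Qed.

Lemma cderive_eq (f : C -> C) (z l l' : C) :
  cderive f z l' -> l' = l -> cderive f z l.
Proof. now intros H <-. Qed.

Lemma cderive_const (c z : C) : cderive (fun _ => c) z (RtoC 0).
Proof. apply (@is_derive_const C_AbsRing C_NormedModule). Qed.

Lemma cderive_id (z : C) : cderive (fun w => w) z (RtoC 1).
Proof. apply cderive_abs, (@is_derive_id C_AbsRing). Qed.

Lemma cderive_plus (f g : C -> C) (z a b : C) :
  cderive f z a -> cderive g z b ->
  cderive (fun w => (f w + g w)%C) z (a + b)%C.
Proof. apply (@is_derive_plus C_AbsRing C_NormedModule). Qed.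

Lemma cderive_opp (f : C -> C) (z a : C) :
  cderive f z a -> cderive (fun w => (- f w)%C) z (- a)%C.
Proof. apply (@is_derive_opp C_AbsRing C_NormedModule). Qed.

Lemma cderive_minus (f g : C -> C) (z a b : C) :
  cderive f z a -> cderive g z b ->
  cderive (fun w => (f w - g w)%C) z (a - b)%C.
Proof. apply (@is_derive_minus C_AbsRing C_NormedModule). Qed.

Lemma cderive_mult (f g : C -> C) (z a b : C) :
  cderive f z a -> cderive g z b ->
  cderive (fun w => (f w * g w)%C) z (a * g z + f z * b)%C.
Proof.
intros Hf Hg; apply cderive_abs, (@is_derive_mult C_AbsRing f g z a b).
- now apply cderive_abs.
- now apply cderive_abs.
- intros; apply Cmult_comm.
Qed.

Lemma cderive_inv (z : C) :
  z <> RtoC 0 -> cderive (fun w => (/ w)%C) z (- / (z * z))%C.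
Proof.
intros Hz; apply cderive_eps; intros eps.
assert (Hm := proj1 (Cmod_gt_0 z) Hz).
assert (Hd : 0 < Rmin (Cmod z / 2) (eps * (Cmod z * Cmod z * Cmod z) / 2)).
{ apply Rmin_pos; [lra |].
  assert (0 < eps * (Cmod z * Cmod z * Cmod z)); [| lra].
  apply Rmult_lt_0_compat; [apply cond_pos |].
  repeat apply Rmult_lt_0_compat; lra. }
exists (mkposreal _ Hd); simpl; intros w Hw.
assert (Hw1 := Rlt_le_trans _ _ _ Hw (Rmin_l _ _)).
assert (Hw2 := Rlt_le_trans _ _ _ Hw (Rmin_r _ _)).
assert (Hwm : Cmod z / 2 < Cmod w).
{ assert (Ht := Cmod_triangle w (z - w)).
  replace (w + (z - w))%C with z in Ht by ring.
  rewrite <- (Cmod_opp (z - w)) in Ht.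
  replace (- (z - w))%C with (w - z)%C in Ht by ring. lra. }
assert (Hw0 : w <> RtoC 0).
{ apply Cmod_gt_0; lra. }
replace (/ w - / z - (w - z) * - / (z * z))%C
  with ((w - z) * (w - z) * / (w * (z * z)))%C by (field; auto).
assert (Hwz : (w * (z * z))%C <> RtoC 0) by (repeat apply Cmult_neq_0; auto).
rewrite !Cmod_mult, Cmod_inv, !Cmod_mult by exact Hwz.
rewrite (Rmult_comm eps), Rmult_assoc.
apply Rmult_le_compat_l; [apply Cmod_ge_0 |].
apply (Rmult_le_reg_r (Cmod w * (Cmod z * Cmod z)));
  [repeat apply Rmult_lt_0_compat; lra |].
rewrite Rmult_assoc, Rinv_l, Rmult_1_r
  by (apply Rgt_not_eq; repeat apply Rmult_lt_0_compat; lra).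
assert (He := cond_pos eps).
assert (eps * (Cmod z * Cmod z) * (Cmod z / 2) <=
        eps * (Cmod z * Cmod z) * Cmod w); [| lra].
apply Rmult_le_compat_l; [| lra].
apply Rmult_le_pos; [lra |]. apply Rmult_le_pos; lra.
Qed.

Lemma ex_cderive_div (f g : C -> C) (z : C) :
  ex_cderive f z -> ex_cderive g z -> g z <> RtoC 0 ->
  ex_cderive (fun w => (f w / g w)%C) z.
Proof.
intros [a Hf] [b Hg] H0; eexists; apply (cderive_mult f (fun w => (/ g w)%C)); [exact Hf |].
apply (@is_derive_comp C_AbsRing C_NormedModule (fun w => (/ w)%C) g);
  [exact (cderive_inv (g z) H0) | exact (proj1 (cderive_abs _ _ _) Hg)].
Qed.

Lemma rderive_iff (f : R -> C) (x : R) (l : C) :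
  rderive f x l <->
  is_derive (fun s => Re (f s)) x (Re l) /\
  is_derive (fun s => Im (f s)) x (Im l).
Proof.
split.
- intros H; split.
  + apply (filterdiff_comp' (V := C_R_NormedModule) f fst x
             (fun y => scal y l) fst H), filterdiff_linear.
    apply (is_linear_fst (U := R_NormedModule) (V := R_NormedModule)).
  + apply (filterdiff_comp' (V := C_R_NormedModule) f snd x
             (fun y => scal y l) snd H), filterdiff_linear.
    apply (is_linear_snd (U := R_NormedModule) (V := R_NormedModule)).
- assert (Hd : forall c : C, c =
     plus (scal (Re c) (RtoC 1 : C_R_NormedModule))
          (scal (Im c) (Ci : C_R_NormedModule))).
  { intros [c1 c2]; apply injective_projections; cbn;
      unfold plus, scal, mult; cbn; unfold mult; cbn; ring. }
  intros [H1 H2].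
  apply (is_derive_ext (V := C_R_NormedModule) (fun s =>
     plus (scal (Re (f s)) (RtoC 1 : C_R_NormedModule))
          (scal (Im (f s)) (Ci : C_R_NormedModule)))).
  { intros t; symmetry; apply Hd. }
  rewrite (Hd l).
  apply (is_derive_plus (V := C_R_NormedModule));
    now apply (is_derive_scal_l (V := C_R_NormedModule)).
Qed.

Lemma rderive_eq (f : R -> C) (x : R) (l l' : C) :
  rderive f x l' -> l' = l -> rderive f x l.
Proof. now intros H <-. Qed.

Lemma is_derive_val (f : R -> R) (x l l' : R) :
  is_derive f x l' -> l' = l -> is_derive f x l.
Proof. now intros H <-. Qed.

Lemma rderive_const (c : C) (x : R) : rderive (fun _ => c) x (RtoC 0).
Proof. apply (@is_derive_const R_AbsRing C_R_NormedModule). Qed.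

Lemma rderive_plus (f g : R -> C) (x : R) (a b : C) :
  rderive f x a -> rderive g x b ->
  rderive (fun s => (f s + g s)%C) x (a + b)%C.
Proof. apply (@is_derive_plus R_AbsRing C_R_NormedModule). Qed.

Lemma rderive_opp (f : R -> C) (x : R) (a : C) :
  rderive f x a -> rderive (fun s => (- f s)%C) x (- a)%C.
Proof. apply (@is_derive_opp R_AbsRing C_R_NormedModule). Qed.

Lemma rderive_minus (f g : R -> C) (x : R) (a b : C) :
  rderive f x a -> rderive g x b ->
  rderive (fun s => (f s - g s)%C) x (a - b)%C.
Proof. apply (@is_derive_minus R_AbsRing C_R_NormedModule). Qed.

Lemma rderive_mult (f g : R -> C) (x : R) (a b : C) :
  rderive f x a -> rderive g x b ->
  rderive (fun s => (f s * g s)%C) x (a * g x + f x * b)%C.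
Proof.
intros Hf Hg; apply rderive_iff in Hf, Hg; apply rderive_iff.
destruct Hf as [F1 F2], Hg as [G1 G2]; split.
- eapply is_derive_val.
  + apply (is_derive_minus (V := R_NormedModule)
             (fun s => Re (f s) * Re (g s)) (fun s => Im (f s) * Im (g s)));
      apply (is_derive_mult (K := R_AbsRing)); try eassumption;
      intros; apply Rmult_comm.
  + unfold minus, plus, opp, mult, Re, Im; cbn; ring.
- eapply is_derive_val.
  + apply (is_derive_plus (V := R_NormedModule)
             (fun s => Re (f s) * Im (g s)) (fun s => Im (f s) * Re (g s)));
      apply (is_derive_mult (K := R_AbsRing)); try eassumption;
      intros; apply Rmult_comm.
  + unfold minus, plus, opp, mult, Re, Im; cbn; ring.
Qed.

Lemma rderive_RtoC (f : R -> R) (x l : R) :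
  is_derive f x l -> rderive (fun s => RtoC (f s)) x (RtoC l).
Proof.
intros H; apply rderive_iff; split; cbn; [exact H |].
apply (is_derive_const (V := R_NormedModule)).
Qed.

Lemma rderive_conj (f : R -> C) (x : R) (l : C) :
  rderive f x l -> rderive (fun s => Cconj (f s)) x (Cconj l).
Proof.
intros H; apply rderive_iff in H; destruct H as [H1 H2].
apply rderive_iff; split; cbn; [exact H1 |].
now apply (is_derive_opp (V := R_NormedModule)).
Qed.

Lemma rderive_continuous (f : R -> C) (x : R) (l : C) :
  rderive f x l -> continuous (U := C_R_NormedModule) f x.
Proof.
intros H; apply (ex_derive_continuous (V := C_R_NormedModule)); now exists l.
Qed.

(** Differentiates a polynomial expression in functions whose derivatives are
    in the context, leaving only the comparison of the two values. *)
Ltac rder_step :=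
  match goal with
  | |- is_derive (fun _ => ?c) _ _ => apply rderive_const
  | |- is_derive (fun s => (@?f s + @?g s)%C) _ _ => apply (rderive_plus f g)
  | |- is_derive (fun s => (@?f s - @?g s)%C) _ _ => apply (rderive_minus f g)
  | |- is_derive (fun s => (@?f s * @?g s)%C) _ _ => apply (rderive_mult f g)
  | |- is_derive (fun s => (- @?f s)%C) _ _ => apply (rderive_opp f)
  | |- is_derive (fun s => RtoC (@?f s)) _ _ => apply (rderive_RtoC f)
  | |- _ => eassumption
  end.
Ltac rder := eapply rderive_eq; [repeat rder_step |].
Ltac cder_step :=
  match goal with
  | |- is_derive (fun _ => ?c) _ _ => apply cderive_const
  | |- is_derive (fun w => w) _ _ => apply cderive_id
  | |- is_derive (fun w => (@?f w + @?g w)%C) _ _ => apply (cderive_plus f g)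
  | |- is_derive (fun w => (@?f w - @?g w)%C) _ _ => apply (cderive_minus f g)
  | |- is_derive (fun w => (@?f w * @?g w)%C) _ _ => apply (cderive_mult f g)
  | |- is_derive (fun w => (- @?f w)%C) _ _ => apply (cderive_opp f)
  | |- _ => eassumption
  end.
Ltac cder := eapply cderive_eq; [repeat cder_step |].

Lemma continuous_Cmult (f g : R -> C) (x : R) :
  continuous (U := C_R_NormedModule) f x ->
  continuous (U := C_R_NormedModule) g x ->
  continuous (U := C_R_NormedModule) (fun s => (f s * g s)%C) x.
Proof.
intros Hf Hg.
assert (Hc : forall h : R -> C, continuous (U := C_R_NormedModule) h x ->
  continuous (fun s => fst (h s)) x /\ continuous (fun s => snd (h s)) x).
{ intros h Hh; split; apply (continuous_comp (V := C_UniformSpace) h _ x Hh);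
    destruct (h x); [apply continuous_fst | apply continuous_snd]. }
destruct (Hc f Hf) as [F1 F2], (Hc g Hg) as [G1 G2].
apply (continuous_comp_2 (U := R_UniformSpace) (V := R_UniformSpace)
  (W := R_UniformSpace) (X := C_UniformSpace)
  (fun s => fst (f s) * fst (g s) - snd (f s) * snd (g s))
  (fun s => fst (f s) * snd (g s) + snd (f s) * fst (g s)) (fun a b => (a, b))).
- apply (continuous_minus (V := R_NormedModule));
    now apply (continuous_mult (K := R_AbsRing)).
- apply (continuous_plus (V := R_NormedModule));
    now apply (continuous_mult (K := R_AbsRing)).
- apply (continuous_ext (T := C_UniformSpace) (U := C_UniformSpace) (fun p => p)).
  + now intros [u v].
  + apply continuous_id.
Qed.

Lemma continuous_Cplus (f g : R -> C) (x : R) :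
  continuous (U := C_R_NormedModule) f x ->
  continuous (U := C_R_NormedModule) g x ->
  continuous (U := C_R_NormedModule) (fun s => (f s + g s)%C) x.
Proof. apply (continuous_plus (V := C_R_NormedModule)). Qed.

Lemma continuous_Cminus (f g : R -> C) (x : R) :
  continuous (U := C_R_NormedModule) f x ->
  continuous (U := C_R_NormedModule) g x ->
  continuous (U := C_R_NormedModule) (fun s => (f s - g s)%C) x.
Proof. apply (continuous_minus (V := C_R_NormedModule)). Qed.

Lemma bounded_on_segment (f : R -> C) (a b : R) :
  (forall s, Rmin a b <= s <= Rmax a b ->
     continuous (U := C_R_NormedModule) f s) ->
  exists B, 0 <= B /\
    forall s, Rmin a b <= s <= Rmax a b -> Cmod (f s) <= B.
Proof.
intros H.
destruct (continuity_ab_maj (fun s => Cmod (f s)) (Rmin a b) (Rmax a b))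
  as [m [Hm _]].
- apply Rminmax.
- intros s Hs; apply continuity_pt_filterlim.
  apply (continuous_comp (V := C_UniformSpace) f Cmod); [now apply H |].
  exact (filterlim_norm (V := C_NormedModule) (f s)).
- exists (Cmod (f m)); split; [apply Cmod_ge_0 | exact Hm].
Qed.

(** The mean value theorem for the real and the imaginary part. *)
Lemma rderive_zero_constant (f : R -> C) (a b : R) :
  (forall s, Rmin a b <= s <= Rmax a b -> rderive f s (RtoC 0)) -> f a = f b.
Proof.
intros H.
assert (Hc : forall g : R -> R,
  (forall s, Rmin a b <= s <= Rmax a b -> is_derive g s 0) -> g a = g b).
{ intros g Hg.
  destruct (MVT_gen g a b (fun _ => 0)) as [c [_ Hc]].
  - intros; apply Hg; lra.
  - intros s Hs; apply continuity_pt_filterlim.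
    apply (ex_derive_continuous g); exists 0; now apply Hg.
  - lra. }
apply injective_projections.
- apply (Hc (fun s => Re (f s))); intros s Hs; exact (proj1 (proj1 (rderive_iff _ _ _) (H s Hs))).
- apply (Hc (fun s => Im (f s))); intros s Hs; exact (proj2 (proj1 (rderive_iff _ _ _) (H s Hs))).
Qed.

(** * Linear systems along a segment *)

(** The point [s1] may lie on either side of [s0]; solutions are propagated in
    both directions. *)
Lemma gronwall (M dM : R -> R) (c s0 s1 : R) :
  (forall s, Rmin s0 s1 <= s <= Rmax s0 s1 ->
     is_derive M s (dM s) /\ Rabs (dM s) <= c * M s) ->
  M s1 <= M s0 * exp (c * Rabs (s1 - s0)).
Proof.
intros H.
(* The weight decreases in the direction from s0 to s1, fast enough to make
   the weighted function monotone. *)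
assert (Hw : forall sg s, (sg = 1 \/ sg = -1) ->
  Rmin s0 s1 <= s <= Rmax s0 s1 ->
  is_derive (fun s => M s * exp (- sg * c * (s - s0))) s
    ((dM s - sg * c * M s) * exp (- sg * c * (s - s0)))).
{ intros sg s _ Hs; destruct (H s Hs) as [Hd _].
  eapply is_derive_val.
  - apply (is_derive_mult (K := R_AbsRing) M
             (fun s => exp (- sg * c * (s - s0)))); [exact Hd | |].
    + apply (is_derive_comp (V := R_NormedModule) exp).
      * apply is_derive_exp.
      * auto_derive; [exact I | reflexivity].
    + intros; apply Rmult_comm.
  - unfold plus, mult, scal; cbn; unfold mult; cbn; ring. }
assert (Hm : forall sg, (sg = 1 \/ sg = -1) -> 0 <= sg * (s1 - s0) ->
  M s1 * exp (- sg * c * (s1 - s0)) <= M s0).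
{ intros sg Hsg Hs01.
  destruct (MVT_gen (fun s => M s * exp (- sg * c * (s - s0))) s0 s1
    (fun s => (dM s - sg * c * M s) * exp (- sg * c * (s - s0))))
    as [s [Hs He]].
  - intros s Hs; apply Hw; [exact Hsg | lra].
  - intros s Hs; apply continuity_pt_filterlim.
    apply (ex_derive_continuous (V := R_NormedModule)
             (fun s => M s * exp (- sg * c * (s - s0)))).
    eexists; apply Hw; [exact Hsg | lra].
  - cbv beta in He; rewrite Rminus_diag, Rmult_0_r, exp_0, Rmult_1_r in He.
    assert (Hle : (dM s - sg * c * M s) * exp (- sg * c * (s - s0))
                  * (s1 - s0) <= 0); [| lra].
    destruct (H s Hs) as [_ Hb].
    assert (Hp := exp_pos (- sg * c * (s - s0))).
    assert (Hab := Rle_abs (dM s)).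
    assert (Hab' := Rle_abs (- dM s)); rewrite Rabs_Ropp in Hab'.
    replace ((dM s - sg * c * M s) * exp (- sg * c * (s - s0)) * (s1 - s0))
      with (- (exp (- sg * c * (s - s0)) *
               ((sg * sg * c * M s - sg * dM s) * (sg * (s1 - s0))) / (sg * sg)))
      by (field; destruct Hsg; lra).
    assert (0 <= exp (- sg * c * (s - s0)) *
      ((sg * sg * c * M s - sg * dM s) * (sg * (s1 - s0)))).
    { apply Rmult_le_pos; [lra |]; apply Rmult_le_pos; [| exact Hs01].
      destruct Hsg; subst sg; lra. }
    replace (sg * sg) with 1 by (destruct Hsg; subst sg; lra).
    replace (sg * sg) with 1 in H0 by (destruct Hsg; subst sg; lra). lra. }
assert (Hfin : forall sg, (sg = 1 \/ sg = -1) -> 0 <= sg * (s1 - s0) ->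
  M s1 <= M s0 * exp (c * Rabs (s1 - s0))).
{ intros sg Hsg Hs; specialize (Hm sg Hsg Hs).
  replace (Rabs (s1 - s0)) with (sg * (s1 - s0)).
  2: { destruct Hsg; subst sg;
       [rewrite Rabs_pos_eq | rewrite Rabs_left1]; lra. }
  apply (Rmult_le_compat_r (exp (c * (sg * (s1 - s0))))) in Hm;
    [| left; apply exp_pos].
  rewrite Rmult_assoc, <- exp_plus in Hm.
  replace (- sg * c * (s1 - s0) + c * (sg * (s1 - s0))) with 0 in Hm by ring.
  rewrite exp_0 in Hm; lra. }
destruct (Rle_dec s0 s1); [apply (Hfin 1) | apply (Hfin (-1))]; lra.
Qed.

Lemma Cmod_sqr (z : C) : Cmod z ^ 2 = Re z ^ 2 + Im z ^ 2.
Proof.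
unfold Cmod, Re, Im; rewrite pow2_sqrt; [ring |].
apply Rplus_le_le_0_compat; apply pow2_ge_0.
Qed.

Lemma is_derive_Cmod_sqr (f : R -> C) (x : R) (l : C) :
  rderive f x l ->
  exists d, is_derive (fun s => Cmod (f s) ^ 2) x d /\
            Rabs d <= 2 * (Cmod (f x) * Cmod l).
Proof.
intros H; apply rderive_iff in H; destruct H as [H1 H2].
exists (2 * Re (f x * Cconj l)%C); split.
- apply (is_derive_ext (fun s => Re (f s) * Re (f s) + Im (f s) * Im (f s))).
  { intros t.
    change (Re (f t) * Re (f t) + Im (f t) * Im (f t) = Cmod (f t) ^ 2).
    rewrite Cmod_sqr; ring. }
  eapply is_derive_val.
  + apply (is_derive_plus (V := R_NormedModule)
      (fun s => Re (f s) * Re (f s)) (fun s => Im (f s) * Im (f s)));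
      apply (is_derive_mult (K := R_AbsRing)); try eassumption;
      intros; apply Rmult_comm.
  + unfold plus, mult, Re, Im; cbn; ring.
- rewrite Rabs_mult, (Rabs_pos_eq 2) by lra.
  apply Rmult_le_compat_l; [lra |].
  eapply Rle_trans; [apply re_le_Cmod |].
  now rewrite Cmod_mult, Cmod_conj; apply Rle_refl.
Qed.

(** Adding the square of the inhomogeneity to the squared length turns the
    estimate into a homogeneous one. *)
Lemma gronwall_pair (y z dy dz : R -> C) (K eps s0 s1 : R) :
  0 <= K ->
  (forall s, Rmin s0 s1 <= s <= Rmax s0 s1 ->
     rderive y s (dy s) /\ rderive z s (dz s) /\
     Cmod (dy s) <= K * (Cmod (y s) + Cmod (z s)) + eps /\
     Cmod (dz s) <= K * (Cmod (y s) + Cmod (z s)) + eps) ->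
  Cmod (y s1) ^ 2 + Cmod (z s1) ^ 2 + eps ^ 2 <=
  (Cmod (y s0) ^ 2 + Cmod (z s0) ^ 2 + eps ^ 2)
    * exp ((4 * K + 2) * Rabs (s1 - s0)).
Proof.
intros HK H.
pose (M := fun s => Cmod (y s) ^ 2 + Cmod (z s) ^ 2 + eps ^ 2).
assert (HM : forall s, Rmin s0 s1 <= s <= Rmax s0 s1 -> exists d,
  is_derive M s d /\ Rabs d <= (4 * K + 2) * M s).
{ intros s Hs; destruct (H s Hs) as (Hy & Hz & By & Bz).
  destruct (is_derive_Cmod_sqr _ _ _ Hy) as (d1 & D1 & B1).
  destruct (is_derive_Cmod_sqr _ _ _ Hz) as (d2 & D2 & B2).
  exists (d1 + d2); split.
  - unfold M; eapply is_derive_val.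
    + apply (is_derive_plus (V := R_NormedModule)).
      * apply (is_derive_plus (V := R_NormedModule)); eassumption.
      * apply (is_derive_const (V := R_NormedModule)).
    + unfold plus, zero; cbn; ring.
  - eapply Rle_trans; [apply Rabs_triang |].
    unfold M.
    assert (Py := Cmod_ge_0 (y s)); assert (Pz := Cmod_ge_0 (z s)).
    set (u := Cmod (y s)) in *; set (v := Cmod (z s)) in *.
    assert (C1 := Rmult_le_compat_l _ _ _ Py By).
    assert (C2 := Rmult_le_compat_l _ _ _ Pz Bz).
    assert (0 <= K * (u - v) ^ 2)
      by (apply Rmult_le_pos; [lra | apply pow2_ge_0]).
    assert (0 <= K * eps ^ 2)
      by (apply Rmult_le_pos; [lra | apply pow2_ge_0]).
    assert (0 <= (u - eps) ^ 2) by apply pow2_ge_0.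
    assert (0 <= (v - eps) ^ 2) by apply pow2_ge_0.
    assert (0 <= u ^ 2) by apply pow2_ge_0.
    assert (0 <= v ^ 2) by apply pow2_ge_0.
    nra. }
apply (gronwall M (fun s => Derive M s)).
intros s Hs; destruct (HM s Hs) as (d & D & B).
now rewrite (is_derive_unique _ _ _ D).
Qed.

(** Variation of constants: the coefficients with respect to the fundamental
    system are primitives of its Wronskians with the inhomogeneity. *)
Lemma linear_system_solution (a b s0 : R) (al be ga y0 z0 y1 z1 by_ bz : R -> C)
    (cy cz : C) :
  a < s0 < b ->
  (forall s, a < s < b ->
     rderive y0 s (y0 s * al s + z0 s * ga s)%C /\
     rderive z0 s (y0 s * be s - z0 s * al s)%C /\
     rderive y1 s (y1 s * al s + z1 s * ga s)%C /\
     rderive z1 s (y1 s * be s - z1 s * al s)%C /\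
     (y0 s * z1 s - z0 s * y1 s)%C = RtoC 1 /\
     continuous (U := C_R_NormedModule) by_ s /\
     continuous (U := C_R_NormedModule) bz s) ->
  exists y z : R -> C, y s0 = cy /\ z s0 = cz /\
    forall s, a < s < b ->
      rderive y s (y s * al s + z s * ga s + by_ s)%C /\
      rderive z s (y s * be s - z s * al s + bz s)%C.
Proof.
intros Hs0 H.
assert (Hint : forall f : R -> C,
  (forall s, a < s < b -> continuous (U := C_R_NormedModule) f s) ->
  forall c : C, exists F : R -> C, F s0 = c /\
    forall s, a < s < b -> rderive F s (f s)).
{ intros f Hf c.
  exists (fun s => (c + RInt (V := C_R_CompleteNormedModule) f s0 s)%C); split.
  - rewrite (RInt_point (V := C_R_CompleteNormedModule)).
    exact (Cplus_0_r c).
  - intros s Hs.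
    eapply rderive_eq; [apply rderive_plus; [apply rderive_const |] | apply Cplus_0_l].
    apply (is_derive_RInt (V := C_R_NormedModule) f _ s0 s); [| now apply Hf].
    assert (Hd : 0 < Rmin (s - a) (b - s)) by (apply Rmin_pos; lra).
    exists (mkposreal _ Hd); intros t Ht.
    apply (RInt_correct (V := C_R_CompleteNormedModule)).
    apply (ex_RInt_continuous (V := C_R_CompleteNormedModule)).
    intros r Hr; apply Hf.
    assert (Ht' : Rabs (t - s) < Rmin (s - a) (b - s)) by exact Ht.
    apply Rabs_def2 in Ht'.
    assert (M1 := Rmin_l (s - a) (b - s)); assert (M2 := Rmin_r (s - a) (b - s)).
    revert Hr; unfold Rmin, Rmax; destruct (Rle_dec s0 t); lra. }
assert (Hcont : forall s, a < s < b ->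
  continuous (U := C_R_NormedModule) y0 s /\
  continuous (U := C_R_NormedModule) z0 s /\
  continuous (U := C_R_NormedModule) y1 s /\
  continuous (U := C_R_NormedModule) z1 s).
{ intros s Hs; destruct (H s Hs) as (D1 & D2 & D3 & D4 & _).
  repeat split; eapply rderive_continuous; eassumption. }
destruct (Hint (fun s => by_ s * z1 s - bz s * y1 s)%C) with
  (c := (cy * z1 s0 - cz * y1 s0)%C) as (u0 & U0 & Du0).
{ intros s Hs; destruct (Hcont s Hs) as (? & ? & ? & ?).
  destruct (H s Hs) as (_ & _ & _ & _ & _ & ? & ?).
  apply continuous_Cminus; now apply continuous_Cmult. }
destruct (Hint (fun s => y0 s * bz s - z0 s * by_ s)%C) with
  (c := (y0 s0 * cz - z0 s0 * cy)%C) as (u1 & U1 & Du1).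
{ intros s Hs; destruct (Hcont s Hs) as (? & ? & ? & ?).
  destruct (H s Hs) as (_ & _ & _ & _ & _ & ? & ?).
  apply continuous_Cminus; now apply continuous_Cmult. }
exists (fun s => u0 s * y0 s + u1 s * y1 s)%C,
       (fun s => u0 s * z0 s + u1 s * z1 s)%C.
split; [| split; [| intros s Hs; split]].
- destruct (H s0 Hs0) as (_ & _ & _ & _ & W & _).
  rewrite U0, U1.
  transitivity (cy * (y0 s0 * z1 s0 - z0 s0 * y1 s0))%C; [ring |].
  rewrite W; ring.
- destruct (H s0 Hs0) as (_ & _ & _ & _ & W & _).
  rewrite U0, U1.
  transitivity (cz * (y0 s0 * z1 s0 - z0 s0 * y1 s0))%C; [ring |].
  rewrite W; ring.
- destruct (H s Hs) as (D1 & D2 & D3 & D4 & W & _).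
  assert (V0 := Du0 s Hs); assert (V1 := Du1 s Hs); cbv beta in V0, V1.
  rder.
  transitivity ((u0 s * y0 s + u1 s * y1 s) * al s
    + (u0 s * z0 s + u1 s * z1 s) * ga s
    + by_ s * (y0 s * z1 s - z0 s * y1 s))%C; [ring | rewrite W; ring].
- destruct (H s Hs) as (D1 & D2 & D3 & D4 & W & _).
  assert (V0 := Du0 s Hs); assert (V1 := Du1 s Hs); cbv beta in V0, V1.
  rder.
  transitivity ((u0 s * y0 s + u1 s * y1 s) * be s
    - (u0 s * z0 s + u1 s * z1 s) * al s
    + bz s * (y0 s * z1 s - z0 s * y1 s))%C; [ring | rewrite W; ring].
Qed.

(** * Taylor expansion in the spectral parameter *)

(** Holomorphy at a removable singularity needs second-order differentiability
    in the spectral parameter; a cubic remainder is the form of it that a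
    Gronwall estimate can transport. *)
Definition jet2 (f : C -> C) (c1 c2 : C) : Prop :=
  exists B d : R, 0 < d /\ forall m : C, Cmod m < d ->
    Cmod (f m - f (RtoC 0) - m * c1 - m * m * c2) <= B * Cmod m ^ 3.

Definition cubic (c : nat -> R -> C) (m : C) (s : R) : C :=
  (c 0%nat s + m * c 1%nat s + m * m * c 2%nat s + m * m * m * c 3%nat s)%C.

Lemma Cmod_plus_le (u v : C) (a b : R) :
  Cmod u <= a -> Cmod v <= b -> Cmod (u + v) <= a + b.
Proof. intros; eapply Rle_trans; [apply Cmod_triangle | lra]. Qed.

Lemma Cmod_minus_le (u v : C) (a b : R) :
  Cmod u <= a -> Cmod v <= b -> Cmod (u - v) <= a + b.
Proof.
intros; apply Cmod_plus_le; [assumption | now rewrite Cmod_opp].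
Qed.

Lemma Cmod_mult_le (u v : C) (a b : R) :
  Cmod u <= a -> Cmod v <= b -> Cmod (u * v) <= a * b.
Proof.
intros; rewrite Cmod_mult; apply Rmult_le_compat;
  auto using Cmod_ge_0.
Qed.

Ltac cbound :=
  match goal with
  | H : Cmod ?u <= _ |- Cmod ?u <= _ => exact H
  | |- Cmod (_ + _)%C <= _ => apply Cmod_plus_le; cbound
  | |- Cmod (_ - _)%C <= _ => apply Cmod_minus_le; cbound
  | |- Cmod (_ * _)%C <= _ => apply Cmod_mult_le; cbound
  end.

(** The Taylor coefficients are defined as solutions of the linear systems
    obtained by comparing the coefficients of [m] and [m ^ 2], with the
    coefficients at [s0] as initial values.  The remainder then solves the
    original system up to an inhomogeneity of order [m ^ 3], and is itself of
    this order at [s0]. *)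
Lemma jet_propagation (a b s0 : R) (al be ga : nat -> R -> C)
    (y z : C -> R -> C) (u0 v0 u1 v1 : R -> C) (c1 d1 c2 d2 : C) :
  a < s0 < b ->
  (forall j s, a < s < b ->
     continuous (U := C_R_NormedModule) (al j) s /\
     continuous (U := C_R_NormedModule) (be j) s /\
     continuous (U := C_R_NormedModule) (ga j) s) ->
  (forall m s, a < s < b ->
     rderive (y m) s (y m s * cubic al m s + z m s * cubic ga m s)%C /\
     rderive (z m) s (y m s * cubic be m s - z m s * cubic al m s)%C) ->
  (forall s, a < s < b ->
     rderive u0 s (u0 s * al 0%nat s + v0 s * ga 0%nat s)%C /\
     rderive v0 s (u0 s * be 0%nat s - v0 s * al 0%nat s)%C /\
     rderive u1 s (u1 s * al 0%nat s + v1 s * ga 0%nat s)%C /\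
     rderive v1 s (u1 s * be 0%nat s - v1 s * al 0%nat s)%C /\
     (u0 s * v1 s - v0 s * u1 s)%C = RtoC 1) ->
  jet2 (fun m => y m s0) c1 c2 -> jet2 (fun m => z m s0) d1 d2 ->
  exists y1 z1 y2 z2 : R -> C, forall s, a < s < b ->
    rderive y1 s (y1 s * al 0%nat s + z1 s * ga 0%nat s
      + (y (RtoC 0) s * al 1%nat s + z (RtoC 0) s * ga 1%nat s))%C /\
    rderive z1 s (y1 s * be 0%nat s - z1 s * al 0%nat s
      + (y (RtoC 0) s * be 1%nat s - z (RtoC 0) s * al 1%nat s))%C /\
    jet2 (fun m => y m s) (y1 s) (y2 s) /\
    jet2 (fun m => z m s) (z1 s) (z2 s).
Proof.
intros Hs0 Hc Hyz Hf Jy Jz.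
assert (H0 : forall s, a < s < b ->
  rderive (y (RtoC 0)) s (y (RtoC 0) s * al 0%nat s + z (RtoC 0) s * ga 0%nat s)%C /\
  rderive (z (RtoC 0)) s (y (RtoC 0) s * be 0%nat s - z (RtoC 0) s * al 0%nat s)%C).
{ intros s Hs; destruct (Hyz (RtoC 0) s Hs) as [Hy Hz]; split;
    (eapply rderive_eq; [eassumption | unfold cubic; ring]). }
assert (K0 : forall s, a < s < b ->
  continuous (U := C_R_NormedModule) (y (RtoC 0)) s /\
  continuous (U := C_R_NormedModule) (z (RtoC 0)) s).
{ intros s Hs; destruct (H0 s Hs); split; eapply rderive_continuous; eassumption. }
destruct (linear_system_solution a b s0 (al 0%nat) (be 0%nat) (ga 0%nat)
  u0 v0 u1 v1
  (fun s => y (RtoC 0) s * al 1%nat s + z (RtoC 0) s * ga 1%nat s)%C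
  (fun s => y (RtoC 0) s * be 1%nat s - z (RtoC 0) s * al 1%nat s)%C c1 d1)
  as (y1 & z1 & Iy1 & Iz1 & H1); [exact Hs0 | |].
{ intros s Hs; destruct (Hf s Hs) as (? & ? & ? & ? & ?), (K0 s Hs).
  destruct (Hc 1%nat s Hs) as (? & ? & ?).
  do 5 (split; [assumption |]); split.
  - apply continuous_Cplus; now apply continuous_Cmult.
  - apply continuous_Cminus; now apply continuous_Cmult. }
cbv beta in H1.
assert (K1 : forall s, a < s < b ->
  continuous (U := C_R_NormedModule) y1 s /\
  continuous (U := C_R_NormedModule) z1 s).
{ intros s Hs; destruct (H1 s Hs); split; eapply rderive_continuous; eassumption. }
destruct (linear_system_solution a b s0 (al 0%nat) (be 0%nat) (ga 0%nat)
  u0 v0 u1 v1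
  (fun s => (y1 s * al 1%nat s + z1 s * ga 1%nat s)
    + (y (RtoC 0) s * al 2%nat s + z (RtoC 0) s * ga 2%nat s))%C
  (fun s => (y1 s * be 1%nat s - z1 s * al 1%nat s)
    + (y (RtoC 0) s * be 2%nat s - z (RtoC 0) s * al 2%nat s))%C c2 d2)
  as (y2 & z2 & Iy2 & Iz2 & H2); [exact Hs0 | |].
{ intros s Hs; destruct (Hf s Hs) as (? & ? & ? & ? & ?), (K0 s Hs), (K1 s Hs).
  destruct (Hc 1%nat s Hs) as (? & ? & ?), (Hc 2%nat s Hs) as (? & ? & ?).
  do 5 (split; [assumption |]); split.
  - apply continuous_Cplus; apply continuous_Cplus; now apply continuous_Cmult.
  - apply continuous_Cplus; apply continuous_Cminus; now apply continuous_Cmult. }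
cbv beta in H2.
assert (K2 : forall s, a < s < b ->
  continuous (U := C_R_NormedModule) y2 s /\
  continuous (U := C_R_NormedModule) z2 s).
{ intros s Hs; destruct (H2 s Hs); split; eapply rderive_continuous; eassumption. }
exists y1, z1, y2, z2; intros s1 Hs1.
destruct (H1 s1 Hs1) as [Dy1 Dz1]; do 2 (split; [assumption |]).
assert (Hin : forall s, Rmin s0 s1 <= s <= Rmax s0 s1 -> a < s < b).
{ intros s; unfold Rmin, Rmax; destruct (Rle_dec s0 s1); lra. }
(* A common bound for all the functions that enter the remainder. *)
assert (HK : exists K, 0 <= K /\ forall s, Rmin s0 s1 <= s <= Rmax s0 s1 ->
  (forall j, (j <= 3)%nat -> Cmod (al j s) <= K /\ Cmod (be j s) <= K /\ Cmod (ga j s) <= K) /\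
  Cmod (y (RtoC 0) s) <= K /\ Cmod (z (RtoC 0) s) <= K /\
  Cmod (y1 s) <= K /\ Cmod (z1 s) <= K /\ Cmod (y2 s) <= K /\ Cmod (z2 s) <= K).
{ assert (Hb : forall f : R -> C, (forall s, a < s < b ->
    continuous (U := C_R_NormedModule) f s) -> exists B, 0 <= B /\
    forall s, Rmin s0 s1 <= s <= Rmax s0 s1 -> Cmod (f s) <= B).
  { intros f Hfc; apply bounded_on_segment; auto. }
  assert (Hb3 : forall c : nat -> R -> C, (forall j s, a < s < b ->
    continuous (U := C_R_NormedModule) (c j) s) -> exists B, 0 <= B /\
    forall s, Rmin s0 s1 <= s <= Rmax s0 s1 ->
    forall j, (j <= 3)%nat -> Cmod (c j s) <= B).
  { intros c Hcc.
    destruct (Hb (c 0%nat) (Hcc 0%nat)) as (B0 & P0 & Q0).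
    destruct (Hb (c 1%nat) (Hcc 1%nat)) as (B1 & P1 & Q1).
    destruct (Hb (c 2%nat) (Hcc 2%nat)) as (B2 & P2 & Q2).
    destruct (Hb (c 3%nat) (Hcc 3%nat)) as (B3 & P3 & Q3).
    exists (B0 + B1 + B2 + B3); split; [lra |]; intros s Hs j Hj.
    specialize (Q0 s Hs); specialize (Q1 s Hs);
      specialize (Q2 s Hs); specialize (Q3 s Hs).
    destruct j as [| [| [| [| j]]]]; [lra | lra | lra | lra | lia]. }
  destruct (Hb3 al) as (A1 & P1 & Q1); [intros j s Hs; exact (proj1 (Hc j s Hs)) |].
  destruct (Hb3 be) as (A2 & P2 & Q2); [intros j s Hs; exact (proj1 (proj2 (Hc j s Hs))) |].
  destruct (Hb3 ga) as (A3 & P3 & Q3); [intros j s Hs; exact (proj2 (proj2 (Hc j s Hs))) |].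
  destruct (Hb (y (RtoC 0))) as (A4 & P4 & Q4); [apply K0 |].
  destruct (Hb (z (RtoC 0))) as (A5 & P5 & Q5); [apply K0 |].
  destruct (Hb y1) as (A6 & P6 & Q6); [apply K1 |].
  destruct (Hb z1) as (A7 & P7 & Q7); [apply K1 |].
  destruct (Hb y2) as (A8 & P8 & Q8); [apply K2 |].
  destruct (Hb z2) as (A9 & P9 & Q9); [apply K2 |].
  exists (A1 + A2 + A3 + A4 + A5 + A6 + A7 + A8 + A9); split; [lra |].
  intros s Hs; specialize (Q1 s Hs); specialize (Q2 s Hs); specialize (Q3 s Hs);
    specialize (Q4 s Hs); specialize (Q5 s Hs); specialize (Q6 s Hs);
    specialize (Q7 s Hs); specialize (Q8 s Hs); specialize (Q9 s Hs).
  split; [| repeat split; lra].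
  intros j Hj; specialize (Q1 j Hj); specialize (Q2 j Hj); specialize (Q3 j Hj).
  repeat split; lra. }
destruct HK as (K & PK & HK).
destruct Jy as (B1 & e1 & Pe1 & Jy), Jz as (B2 & e2 & Pe2 & Jz).
set (D := B1 ^ 2 + B2 ^ 2 + (12 * K * K) ^ 2).
set (X := exp ((4 * (4 * K) + 2) * Rabs (s1 - s0))).
assert (HDX : 0 <= D * X).
{ apply Rmult_le_pos; [| left; apply exp_pos].
  unfold D; assert (Q1 := pow2_ge_0 B1); assert (Q2 := pow2_ge_0 B2);
    assert (Q3 := pow2_ge_0 (12 * K * K)); lra. }
assert (Hmain : forall m : C, Cmod m < Rmin (Rmin e1 e2) 1 ->
  Cmod (y m s1 - y (RtoC 0) s1 - m * y1 s1 - m * m * y2 s1) ^ 2 +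
  Cmod (z m s1 - z (RtoC 0) s1 - m * z1 s1 - m * m * z2 s1) ^ 2
  <= D * X * (Cmod m ^ 3) ^ 2).
{ intros m Hm.
  assert (Hm1 : Cmod m <= 1) by (assert (Q := Rmin_r (Rmin e1 e2) 1); lra).
  assert (Hme1 : Cmod m < e1).
  { assert (Q := Rmin_l (Rmin e1 e2) 1); assert (Q' := Rmin_l e1 e2); lra. }
  assert (Hme2 : Cmod m < e2).
  { assert (Q := Rmin_l (Rmin e1 e2) 1); assert (Q' := Rmin_r e1 e2); lra. }
  specialize (Jy m Hme1); specialize (Jz m Hme2).
  assert (Pm := Cmod_ge_0 m).
  assert (Pm3 : 0 <= Cmod m ^ 3) by now apply pow_le.
  pose (wy := fun s => (y m s - y (RtoC 0) s - m * y1 s - m * m * y2 s)%C).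
  pose (wz := fun s => (z m s - z (RtoC 0) s - m * z1 s - m * m * z2 s)%C).
  pose (ry := fun s => (y (RtoC 0) s * al 3%nat s + z (RtoC 0) s * ga 3%nat s
    + y1 s * al 2%nat s + z1 s * ga 2%nat s
    + y2 s * al 1%nat s + z2 s * ga 1%nat s
    + m * (y1 s * al 3%nat s + z1 s * ga 3%nat s
           + y2 s * al 2%nat s + z2 s * ga 2%nat s)
    + m * m * (y2 s * al 3%nat s + z2 s * ga 3%nat s))%C).
  pose (rz := fun s => (y (RtoC 0) s * be 3%nat s - z (RtoC 0) s * al 3%nat s
    + y1 s * be 2%nat s - z1 s * al 2%nat s
    + y2 s * be 1%nat s - z2 s * al 1%nat s
    + m * (y1 s * be 3%nat s - z1 s * al 3%nat s
           + y2 s * be 2%nat s - z2 s * al 2%nat s)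
    + m * m * (y2 s * be 3%nat s - z2 s * al 3%nat s))%C).
  (* For [Cmod m <= 1] a cubic has four terms bounded by [K], and each
     component of the inhomogeneity is [m ^ 3] times twelve terms bounded by
     [K * K]. *)
  assert (G := gronwall_pair wy wz
    (fun s => wy s * cubic al m s + wz s * cubic ga m s + m * m * m * ry s)%C
    (fun s => wy s * cubic be m s - wz s * cubic al m s + m * m * m * rz s)%C
    (4 * K) (12 * K * K * Cmod m ^ 3) s0 s1).
  eapply Rle_trans; [| eapply Rle_trans; [apply G |]].
  - fold (wy s1) (wz s1).
    assert (Q := pow2_ge_0 (12 * K * K * Cmod m ^ 3)); lra.
  - lra.
  - intros s Hs.
    destruct (HK s Hs) as (HKj & Ky & Kz & Ky1 & Kz1 & Ky2 & Kz2).
    destruct (HKj 0%nat) as (Ka0 & Kb0 & Kg0); [lia |].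
    destruct (HKj 1%nat) as (Ka1 & Kb1 & Kg1); [lia |].
    destruct (HKj 2%nat) as (Ka2 & Kb2 & Kg2); [lia |].
    destruct (HKj 3%nat) as (Ka3 & Kb3 & Kg3); [lia |].
    destruct (Hyz m s (Hin s Hs)) as [Dy Dz], (H0 s (Hin s Hs)) as [Dy0 Dz0],
      (H1 s (Hin s Hs)) as [Ey1 Ez1], (H2 s (Hin s Hs)) as [Ey2 Ez2].
    assert (Hcub : forall c : nat -> R -> C, Cmod (c 0%nat s) <= K ->
      Cmod (c 1%nat s) <= K -> Cmod (c 2%nat s) <= K -> Cmod (c 3%nat s) <= K ->
      Cmod (cubic c m s) <= 4 * K).
    { intros; unfold cubic; eapply Rle_trans; [cbound | lra]. }
    assert (Bal := Hcub al Ka0 Ka1 Ka2 Ka3).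
    assert (Bbe := Hcub be Kb0 Kb1 Kb2 Kb3).
    assert (Bga := Hcub ga Kg0 Kg1 Kg2 Kg3).
    assert (Bry : Cmod (ry s) <= 12 * K * K)
      by (unfold ry; eapply Rle_trans; [cbound | lra]).
    assert (Brz : Cmod (rz s) <= 12 * K * K)
      by (unfold rz; eapply Rle_trans; [cbound | lra]).
    assert (Hm3 : Cmod (m * m * m) <= Cmod m ^ 3)
      by (rewrite !Cmod_mult; lra).
    assert (Iwy := Rle_refl (Cmod (wy s))); assert (Iwz := Rle_refl (Cmod (wz s))).
    split; [| split; [| split]].
    + unfold wy; rder; unfold wy, wz, ry, cubic; ring.
    + unfold wz; rder; unfold wy, wz, rz, cubic; ring.
    + cbv beta; eapply Rle_trans; [cbound | lra].
    + cbv beta; eapply Rle_trans; [cbound | lra].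
  - fold X. fold (wy s0) (wz s0) in Jy, Jz.
    assert (Fy : Cmod (wy s0) <= B1 * Cmod m ^ 3)
      by (unfold wy; rewrite Iy1, Iy2; exact Jy).
    assert (Fz : Cmod (wz s0) <= B2 * Cmod m ^ 3)
      by (unfold wz; rewrite Iz1, Iz2; exact Jz).
    apply (fun F => pow_incr _ _ 2 (conj (Cmod_ge_0 _) F)) in Fy.
    apply (fun F => pow_incr _ _ 2 (conj (Cmod_ge_0 _) F)) in Fz.
    replace (D * X * (Cmod m ^ 3) ^ 2) with (D * (Cmod m ^ 3) ^ 2 * X) by ring.
    apply Rmult_le_compat_r; [left; apply exp_pos |].
    unfold D; rewrite !Rpow_mult_distr in *; lra. }
assert (He : 0 < Rmin (Rmin e1 e2) 1) by (repeat apply Rmin_pos; lra).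
assert (Hfin : forall w p : R, 0 <= p -> w ^ 2 <= D * X * p ^ 2 ->
  w <= sqrt (D * X) * p).
{ intros w p Hp Hw; 
  rewrite <- (pow2_sqrt (D * X)), <- Rpow_mult_distr in Hw by exact HDX.
  apply Rsqr_incr_0_var; [rewrite !Rsqr_pow2; exact Hw |].
  apply Rmult_le_pos; [apply sqrt_pos | exact Hp]. }
split; exists (sqrt (D * X)), (Rmin (Rmin e1 e2) 1); (split; [exact He |]);
  intros m Hm; specialize (Hmain m Hm); apply Hfin;
  try (apply pow_le, Cmod_ge_0);
  cbv beta; set (w1 := Cmod (y m s1 - _ - _ - _)) in *;
  set (w2 := Cmod (z m s1 - _ - _ - _)) in *;
  assert (Q1 := pow2_ge_0 w1); assert (Q2 := pow2_ge_0 w2); lra.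
Qed.

(** * Removable singularities *)

(** The difference quotient of [f] at [z] extends to a function that is
    differentiable at [z].  This form of second-order differentiability passes
    to sums and products by algebra alone, and it is what remains of [f] after
    division by a simple zero at [z]. *)
Definition divdiff (f : C -> C) (z : C) : Prop :=
  exists g : C -> C, ex_cderive g z /\
    forall w, f w = (f z + (w - z) * g w)%C.

Lemma divdiff_derive (f g : C -> C) (z : C) :
  ex_cderive g z -> (forall w, f w = (f z + (w - z) * g w)%C) ->
  cderive f z (g z).
Proof.
intros [l Hg] Hf.
apply (cderive_ext (fun w => f z + (w - z) * g w)%C).
{ intros w; symmetry; apply Hf. }
cder; ring.
Qed.

Lemma Ceq_minus (a b : C) : (a - b)%C = RtoC 0 -> a = b.
Proof.
intros H; replace a with (a - b + b)%C by ring; rewrite H; ring.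
Qed.

Lemma Cmult_integral (a b : C) :
  (a * b)%C = RtoC 0 -> a = RtoC 0 \/ b = RtoC 0.
Proof.
intros H; destruct (classic (a = RtoC 0)) as [Ha | Ha]; [now left |].
destruct (classic (b = RtoC 0)) as [Hb | Hb]; [now right |].
now destruct (Cmult_neq_0 a b Ha Hb).
Qed.

Lemma jet2_divdiff (f : C -> C) (z c1 c2 : C) :
  jet2 (fun m => f (z + m)%C) c1 c2 ->
  divdiff f z /\ cderive f z c1.
Proof.
intros (B & d & Pd & H).
pose (g := fun w => if excluded_middle_informative (w = z) then c1
                    else ((f w - f z) / (w - z))%C).
assert (Hgz : g z = c1).
{ unfold g; destruct (excluded_middle_informative (z = z)); tauto. }
assert (Hf : forall w, f w = (f z + (w - z) * g w)%C).
{ intros w; unfold g; destruct (excluded_middle_informative (w = z)) as [-> | n].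
  - ring.
  - field; intros E; apply n, Ceq_minus, E. }
assert (Hg : cderive g z c2).
{ apply cderive_eps; intros eps.
  assert (Pb : 0 < 1 + Rabs B) by (assert (Q := Rabs_pos B); lra).
  assert (Hd : 0 < Rmin d (eps / (1 + Rabs B))).
  { apply Rmin_pos; [exact Pd | apply Rdiv_lt_0_compat; [apply cond_pos | exact Pb]]. }
  exists (mkposreal _ Hd); simpl; intros w Hw.
  assert (Hw1 := Rlt_le_trans _ _ _ Hw (Rmin_l _ _)).
  assert (Hw2 := Rlt_le_trans _ _ _ Hw (Rmin_r _ _)).
  rewrite Hgz.
  destruct (excluded_middle_informative (w = z)) as [-> | n].
  { rewrite Hgz; replace (c1 - c1 - (z - z) * c2)%C with (RtoC 0) by ring.
    rewrite Cmod_0; apply Rmult_le_pos; [left; apply cond_pos | apply Cmod_ge_0]. }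
  specialize (H (w - z)%C Hw1); cbv beta in H.
  replace (z + (w - z))%C with w in H by ring.
  replace (z + RtoC 0)%C with z in H by ring.
  assert (Hwz : (w - z)%C <> RtoC 0) by (intros E; apply n, Ceq_minus, E).
  assert (Pw := proj1 (Cmod_gt_0 _) Hwz).
  rewrite (Hf w) in H.
  replace (f z + (w - z) * g w - f z - (w - z) * c1 - (w - z) * (w - z) * c2)%C
    with ((w - z) * (g w - c1 - (w - z) * c2))%C in H by ring.
  rewrite Cmod_mult in H.
  apply (Rmult_le_reg_l (Cmod (w - z))); [exact Pw |].
  eapply Rle_trans; [exact H |].
  assert (HB : B * Cmod (w - z) <= eps).
  { apply (Rmult_lt_compat_l _ _ _ Pb) in Hw2.
    replace ((1 + Rabs B) * (eps / (1 + Rabs B))) with (pos eps) in Hw2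
      by (field; lra).
    assert (Q := Rle_abs B). nra. }
  apply (Rmult_le_compat_r (Cmod (w - z) * Cmod (w - z))) in HB;
    [| apply Rmult_le_pos; lra].
  lra. }
split.
- exists g; split; [now exists c2 | exact Hf].
- rewrite <- Hgz; apply divdiff_derive; [now exists c2 | exact Hf].
Qed.

Lemma divdiff_const (c z : C) : divdiff (fun _ => c) z.
Proof.
exists (fun _ => RtoC 0); split; [| intros; ring].
eexists; apply cderive_const.
Qed.

Lemma divdiff_id (z : C) : divdiff (fun w => w) z.
Proof.
exists (fun _ => RtoC 1); split; [| intros; ring].
eexists; apply cderive_const.
Qed.

Lemma divdiff_plus (f g : C -> C) (z : C) :
  divdiff f z -> divdiff g z -> divdiff (fun w => (f w + g w)%C) z.
Proof.
intros (f' & [a Hf] & Ef) (g' & [b Hg] & Eg).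
exists (fun w => (f' w + g' w)%C); split.
- eexists; apply cderive_plus; eassumption.
- intros w; rewrite (Ef w), (Eg w); ring.
Qed.

Lemma divdiff_minus (f g : C -> C) (z : C) :
  divdiff f z -> divdiff g z -> divdiff (fun w => (f w - g w)%C) z.
Proof.
intros (f' & [a Hf] & Ef) (g' & [b Hg] & Eg).
exists (fun w => (f' w - g' w)%C); split.
- eexists; apply cderive_minus; eassumption.
- intros w; rewrite (Ef w), (Eg w); ring.
Qed.

Lemma divdiff_mult (f g : C -> C) (z : C) :
  divdiff f z -> divdiff g z -> divdiff (fun w => (f w * g w)%C) z.
Proof.
intros (f' & [a Hf] & Ef) (g' & [b Hg] & Eg).
exists (fun w => (f' w * g z + f z * g' w + (w - z) * (f' w * g' w))%C); split.
- eexists; repeat cder_step.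
- intros w; rewrite (Ef w), (Eg w); ring.
Qed.

(** The quotient of a function by [w ^ 2 - k ^ 2], continued to the points
    [k] and [- k] by de l'Hospital's rule. *)
Definition pole_quotient (k : R) (f : C -> C) (w : C) : C :=
  if excluded_middle_informative ((w * w)%C = RtoC (k ^ 2))
  then (C_derive f w / (2 * w))%C
  else (/ (w * w - RtoC (k ^ 2)) * f w)%C.

Lemma ex_cderive_ext_near (f g : C -> C) (z : C) (d : R) :
  0 < d -> (forall w, Cmod (w - z) < d -> f w = g w) ->
  ex_cderive f z -> ex_cderive g z.
Proof.
intros Pd H; apply (ex_derive_ext_loc (V := C_NormedModule)).
exists (mkposreal d Pd); exact H.
Qed.

(** Near a zero [z] of [w ^ 2 - k ^ 2] the quotient is [g w / (w + z)], where [g]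
    is the extended difference quotient of [f] at [z]. *)
Lemma pole_quotient_derivable (k : R) (f : C -> C) (z : C) :
  k <> 0 -> ex_cderive f z ->
  ((z * z)%C = RtoC (k ^ 2) -> f z = RtoC 0 /\ divdiff f z) ->
  ex_cderive (pole_quotient k f) z.
Proof.
intros Hk Hf Hs.
destruct (excluded_middle_informative ((z * z)%C = RtoC (k ^ 2))) as [e | n].
- destruct (Hs e) as [Fz (g & Hg & Eg)].
  assert (Hz : z <> RtoC 0).
  { intros E; rewrite E, Cmult_0_l in e; apply RtoC_inj in e.
    apply Hk, (Rsqr_0_uniq k); unfold Rsqr; lra. }
  assert (Pz := proj1 (Cmod_gt_0 _) Hz).
  assert (H2z : (z + z)%C <> RtoC 0).
  { intros E; apply Hz; replace z with ((z + z) / 2)%C by field; rewrite E; field. }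
  apply (ex_cderive_ext_near (fun w => (g w / (w + z))%C) _ z (Cmod z) Pz).
  + intros w Hw.
    assert (Hwz : (w + z)%C <> RtoC 0).
    { intros E; replace (w - z)%C with ((w + z) - (z + z))%C in Hw by ring.
      rewrite E in Hw; replace (RtoC 0 - (z + z))%C with (-(2) * z)%C in Hw by ring.
      rewrite Cmod_mult, Cmod_opp, Cmod_R, Rabs_pos_eq in Hw; lra. }
    unfold pole_quotient.
    destruct (excluded_middle_informative ((w * w)%C = RtoC (k ^ 2))) as [e' | n].
    * assert (w = z) as ->.
      { apply Ceq_minus.
        assert (Hp : ((w - z) * (w + z))%C = RtoC 0).
        { transitivity (w * w - z * z)%C; [ring | rewrite e, e'; ring]. }
        destruct (Cmult_integral _ _ Hp); tauto. }
      rewrite (is_C_derive_unique f z (g z)) by now apply divdiff_derive.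
      field; split; [exact Hz | exact H2z].
    * rewrite <- e, (Eg w), Fz.
      assert ((w * w - z * z)%C <> RtoC 0).
      { intros E; apply n; rewrite <- e; apply Ceq_minus, E. }
      field; split; assumption.
  + apply ex_cderive_div; [exact Hg | | exact H2z].
    eexists; repeat cder_step.
- assert (Hn : forall c : R, (c = k \/ c = - k) -> 0 < Cmod (z - RtoC c)).
  { intros c Hc; apply Cmod_gt_0; intros E; apply n.
    rewrite (Ceq_minus _ _ E), <- RtoC_mult; f_equal; destruct Hc; subst c; ring. }
  assert (P1 := Hn k (or_introl eq_refl)).
  assert (P2 := Hn (- k) (or_intror eq_refl)).
  apply (ex_cderive_ext_near (fun w => (f w / (w * w - RtoC (k ^ 2)))%C) _ z
    (Rmin (Cmod (z - RtoC k)) (Cmod (z - RtoC (- k)))));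
    [now apply Rmin_pos | |].
  + intros w Hw; unfold pole_quotient.
    destruct (excluded_middle_informative ((w * w)%C = RtoC (k ^ 2))) as [e' | n'].
    * exfalso.
      assert (Q1 := Rlt_le_trans _ _ _ Hw (Rmin_l _ _)).
      assert (Q2 := Rlt_le_trans _ _ _ Hw (Rmin_r _ _)).
      rewrite <- (Cmod_opp (w - z)) in Q1, Q2.
      assert (Hp : ((w - RtoC k) * (w - RtoC (- k)))%C = RtoC 0).
      { rewrite RtoC_opp; transitivity (w * w - RtoC k * RtoC k)%C; [ring |].
        rewrite e', <- RtoC_mult; replace (k ^ 2) with (k * k) by ring; ring. }
      destruct (Cmult_integral _ _ Hp) as [E | E]; apply Ceq_minus in E;
        [rewrite E in Q1 | rewrite E in Q2].
      -- replace (- (RtoC k - z))%C with (z - RtoC k)%C in Q1 by ring; lra.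
      -- replace (- (RtoC (- k) - z))%C with (z - RtoC (- k))%C in Q2 by ring; lra.
    * apply Cmult_comm.
  + apply ex_cderive_div; [exact Hf | eexists; repeat cder_step |].
    intros E; apply n, Ceq_minus, E.
Qed.

(** * The rows of a trivialization *)

Ltac push_RtoC :=
  repeat first
    [ rewrite RtoC_plus | rewrite RtoC_minus | rewrite RtoC_mult
    | rewrite RtoC_opp | rewrite RtoC_pow | rewrite RtoC_div by lra ].

(** The coefficients of the second equation as functions of the values of
    [q], [q_x] and [q_xx]; the matrix is [[al, be], [ga, - al]]. *)
Definition lax_al (q0 q1 : R) (lam : C) : C :=
  (lam * lam * lam - lam * RtoC (q0 / 2) + RtoC (q1 / 4))%C.
Definition lax_be (q0 q1 q2 : R) (lam : C) : C :=
  (lam * lam * RtoC q0 - lam * RtoC (q1 / 2)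
   + RtoC ((q2 - 2 * q0 ^ 2) / 4))%C.
Definition lax_ga (q0 : R) (lam : C) : C := (lam * lam - RtoC (q0 / 2))%C.

Definition row_solution_at (q : R -> R -> R) (lam : C) (y z : R -> R -> C)
    (x t : R) : Prop :=
  let q0 := q x t in
  let q1 := partial_derive 1 0 q x t in
  let q2 := partial_derive 2 0 q x t in
  rderive (fun s => y s t) x (y x t * lam + z x t)%C /\
  rderive (fun s => z s t) x (y x t * RtoC q0 - z x t * lam)%C /\
  rderive (fun s => y x s) t
    (y x t * lax_al q0 q1 lam + z x t * lax_ga q0 lam)%C /\
  rderive (fun s => z x s) t
    (y x t * lax_be q0 q1 q2 lam - z x t * lax_al q0 q1 lam)%C.

Definition row_solution (U : R * R -> Prop) (q : R -> R -> R) (lam : C)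
    (y z : R -> R -> C) : Prop :=
  forall x t, U (x, t) -> row_solution_at q lam y z x t.

Lemma entry_mul {m p : nat} (A : Cmx m 2) (B : Cmx 2 p) (i j : nat) :
  (i < m)%nat -> (j < p)%nat ->
  entry (mxmul A B) i j =
  (entry A i 0 * entry B 0 j + entry A i 1 * entry B 1 j)%C.
Proof.
intros Hi Hj; unfold entry, mxmul, Mmult.
rewrite coeff_mat_bij by lia; simpl pred.
now rewrite sum_Sn, sum_O.
Qed.

Lemma entry_scal (c : C) (A : Cmx 2 2) (i j : nat) :
  (i < 2)%nat -> (j < 2)%nat -> entry (mxscal c A) i j = (c * entry A i j)%C.
Proof.
intros Hi Hj; unfold entry at 1, mxscal; now rewrite coeff_mat_bij by lia.
Qed.

Lemma entry_laxx (q : R -> R -> R) (x t : R) (lam : C) :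
  entry (lax_x q x t lam) 0 0 = lam /\
  entry (lax_x q x t lam) 0 1 = RtoC (q x t) /\
  entry (lax_x q x t lam) 1 0 = RtoC 1 /\
  entry (lax_x q x t lam) 1 1 = (- lam)%C.
Proof.
unfold entry, lax_x, mxadd, mxscal, Mplus, mx_a, mx_u, mx2; cbn -[Cplus Cmult RtoC].
unfold plus; cbn -[Cplus Cmult RtoC]. repeat split; ring.
Qed.

Lemma entry_laxt (q : R -> R -> R) (x t : R) (lam : C) :
  let q0 := q x t in
  let q1 := partial_derive 1 0 q x t in
  let q2 := partial_derive 2 0 q x t in
  entry (lax_t q x t lam) 0 0 = lax_al q0 q1 lam /\
  entry (lax_t q x t lam) 0 1 = lax_be q0 q1 q2 lam /\
  entry (lax_t q x t lam) 1 0 = lax_ga q0 lam /\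
  entry (lax_t q x t lam) 1 1 = (- lax_al q0 q1 lam)%C.
Proof.
intros q0 q1 q2.
assert (Hq0 : q0 = q x t) by reflexivity.
assert (Hq1 : q1 = partial_derive 1 0 q x t) by reflexivity.
assert (Hq2 : q2 = partial_derive 2 0 q x t) by reflexivity.
unfold entry, lax_t, mxadd, mxscal, Mplus, mx_a, mx_u, mx_Q2, mx_Q3, mx2.
rewrite <- Hq0, <- Hq1, <- Hq2; clearbody q0 q1 q2.
unfold lax_al, lax_be, lax_ga.
cbn -[Cplus Cmult RtoC pow].
unfold plus; cbn -[Cplus Cmult RtoC pow].
repeat split; push_RtoC; ring.
Qed.

Definition row_fst (E : R -> R -> C -> Cmx 2 2) (i : nat) (lam : C)
    (x t : R) : C := entry (E x t lam) i 0.
Definition row_snd (E : R -> R -> C -> Cmx 2 2) (i : nat) (lam : C)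
    (x t : R) : C := entry (E x t lam) i 1.

Lemma lax_equations_rows (q : R -> R -> R) (E : R -> R -> C -> Cmx 2 2)
    (x t : R) (lam : C) :
  (mx_is_derive (fun z => E z t lam) x (mxmul (E x t lam) (lax_x q x t lam)) /\
   mx_is_derive (fun s => E x s lam) t (mxmul (E x t lam) (lax_t q x t lam)))
  <->
  (forall i, (i < 2)%nat ->
     row_solution_at q lam (row_fst E i lam) (row_snd E i lam) x t).
Proof.
destruct (entry_laxx q x t lam) as (X00 & X01 & X10 & X11).
destruct (entry_laxt q x t lam) as (T00 & T01 & T10 & T11).
split.
- intros [Hx Ht] i Hi.
  unfold row_solution_at, row_fst, row_snd.
  assert (L0 : (0 < 2)%nat) by lia; assert (L1 : (1 < 2)%nat) by lia.
  assert (A1 := Hx i 0%nat Hi L0); assert (A2 := Hx i 1%nat Hi L1).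
  assert (A3 := Ht i 0%nat Hi L0); assert (A4 := Ht i 1%nat Hi L1).
  rewrite entry_mul in A1, A2, A3, A4 by assumption.
  rewrite X00, X10 in A1; rewrite X01, X11 in A2.
  rewrite T00, T10 in A3; rewrite T01, T11 in A4.
  split; [| split; [| split]]; (eapply rderive_eq; [eassumption | ring]).
- intros H; split; intros i j Hi Hj; rewrite entry_mul by assumption;
    destruct (H i Hi) as (A1 & A2 & A3 & A4); unfold row_fst, row_snd in *;
    destruct j as [| [| j]]; try lia.
  + rewrite X00, X10; eapply rderive_eq; [eassumption | ring].
  + rewrite X01, X11; eapply rderive_eq; [eassumption | ring].
  + rewrite T00, T10; eapply rderive_eq; [eassumption | ring].
  + rewrite T01, T11; eapply rderive_eq; [eassumption | ring].
Qed.

(** * Propagation over a connected open set *)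

Lemma open_box (U : R * R -> Prop) (x t : R) :
  open U -> U (x, t) ->
  exists r, 0 < r /\ forall u v, Rabs (u - x) < r -> Rabs (v - t) < r -> U (u, v).
Proof.
intros HU H; destruct (HU (x, t) H) as [r Hr].
exists r; split; [apply cond_pos |].
intros u v Hu Hv; apply Hr; split; assumption.
Qed.

(** Any two points of a box are joined by two segments parallel to the axes,
    so the set where [P] holds and its complement in [U] are both open. *)
Lemma connected_propagation (U : R * R -> Prop) (P : R -> R -> Prop) :
  open U -> connected_set U -> U (0, 0) -> P 0 0 ->
  (forall a b t, (forall s, a < s < b -> U (s, t)) ->
     forall s0 s1, a < s0 < b -> a < s1 < b -> P s0 t -> P s1 t) ->
  (forall a b x, (forall s, a < s < b -> U (x, s)) ->
     forall s0 s1, a < s0 < b -> a < s1 < b -> P x s0 -> P x s1) ->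
  forall x t, U (x, t) -> P x t.
Proof.
intros HU Hc U0 P0 Hx Ht.
assert (Hloc : forall x t, U (x, t) -> exists r, 0 < r /\
  (forall u v, Rabs (u - x) < r -> Rabs (v - t) < r -> U (u, v)) /\
  forall u v, Rabs (u - x) < r -> Rabs (v - t) < r -> (P x t <-> P u v)).
{ intros x t H; destruct (open_box U x t HU H) as (r & Pr & Hr).
  exists r; split; [exact Pr | split; [exact Hr |]].
  assert (Hbd : forall c s, c - r < s < c + r -> Rabs (s - c) < r)
    by (intros c s Hs; apply Rabs_def1; lra).
  assert (HX : forall u v u', Rabs (v - t) < r -> Rabs (u - x) < r ->
    Rabs (u' - x) < r -> P u v -> P u' v).
  { intros u v u' Hv Hu Hu'; apply (Hx (x - r) (x + r)).
    - intros s Hs; apply Hr; [now apply Hbd | exact Hv].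
    - apply Rabs_def2 in Hu; lra.
    - apply Rabs_def2 in Hu'; lra. }
  assert (HT : forall u v v', Rabs (u - x) < r -> Rabs (v - t) < r ->
    Rabs (v' - t) < r -> P u v -> P u v').
  { intros u v v' Hu Hv Hv'; apply (Ht (t - r) (t + r)).
    - intros s Hs; apply Hr; [exact Hu | now apply Hbd].
    - apply Rabs_def2 in Hv; lra.
    - apply Rabs_def2 in Hv'; lra. }
  assert (Zx : Rabs (x - x) < r) by (rewrite Rminus_diag, Rabs_R0; exact Pr).
  assert (Zt : Rabs (t - t) < r) by (rewrite Rminus_diag, Rabs_R0; exact Pr).
  intros u v Hu Hv; split; intros HP.
  - apply (HT u t v Hu Zt Hv), (HX x t u Zt Zx Hu HP).
  - apply (HX u t x Zt Hu Zx), (HT u v t Hu Hv Zt HP). }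
intros x t H; apply NNPP; intros HnP.
destruct (Hc (fun p => U p /\ P (fst p) (snd p))
             (fun p => U p /\ ~ P (fst p) (snd p))) as (p & _ & HA & HB).
- intros [u v] [Hp HP]; destruct (Hloc u v Hp) as (r & Pr & HrU & Hr).
  exists (mkposreal r Pr); intros [u' v'] [B1 B2].
  split; [now apply HrU | now apply (Hr u' v' B1 B2)].
- intros [u v] [Hp HP]; destruct (Hloc u v Hp) as (r & Pr & HrU & Hr).
  exists (mkposreal r Pr); intros [u' v'] [B1 B2].
  split; [now apply HrU |].
  intros HP'; now apply HP, (Hr u' v' B1 B2).
- intros p Hp; destruct (classic (P (fst p) (snd p))); tauto.
- exists (0, 0); tauto.
- exists (x, t); tauto.
- tauto.
Qed.

Lemma segment_in_interval (a b s0 s1 s : R) :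
  a < s0 < b -> a < s1 < b -> Rmin s0 s1 <= s <= Rmax s0 s1 -> a < s < b.
Proof. unfold Rmin, Rmax; destruct (Rle_dec s0 s1); lra. Qed.

(** Both coefficient matrices are trace-free. *)
Lemma wronskian_constant (U : R * R -> Prop) (q : R -> R -> R) (lam : C)
    (y0 z0 y1 z1 : R -> R -> C) :
  open U -> connected_set U -> U (0, 0) ->
  row_solution U q lam y0 z0 -> row_solution U q lam y1 z1 ->
  forall x t, U (x, t) ->
    (y0 x t * z1 x t - z0 x t * y1 x t)%C =
    (y0 0 0 * z1 0 0 - z0 0 0 * y1 0 0)%C.
Proof.
intros HU Hc U0 H0 H1.
set (w := (y0 0 0 * z1 0 0 - z0 0 0 * y1 0 0)%C).
apply (connected_propagation U
  (fun x t => (y0 x t * z1 x t - z0 x t * y1 x t)%C = w) HU Hc U0 eq_refl).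
- intros a b t Hab s0 s1 Hs0 Hs1 <-.
  apply (rderive_zero_constant (fun s => y0 s t * z1 s t - z0 s t * y1 s t)%C).
  intros s Hs; assert (Hu := Hab s (segment_in_interval a b _ _ s Hs1 Hs0 Hs)).
  destruct (H0 s t Hu) as (A1 & A2 & _ & _), (H1 s t Hu) as (B1 & B2 & _ & _).
  rder; ring.
- intros a b x Hab s0 s1 Hs0 Hs1 <-.
  apply (rderive_zero_constant (fun s => y0 x s * z1 x s - z0 x s * y1 x s)%C).
  intros s Hs; assert (Hu := Hab s (segment_in_interval a b _ _ s Hs1 Hs0 Hs)).
  destruct (H0 x s Hu) as (_ & _ & A1 & A2), (H1 x s Hu) as (_ & _ & B1 & B2).
  rder; ring.
Qed.

Lemma trivialization_rows (U : R * R -> Prop) (q : R -> R -> R)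
    (E : R -> R -> C -> Cmx 2 2) (lam : C) (i : nat) :
  is_trivialization U q E -> (i < 2)%nat ->
  row_solution U q lam (row_fst E i lam) (row_snd E i lam).
Proof.
intros (H & _ & _) Hi x t Hu.
now apply (proj1 (lax_equations_rows q E x t lam) (H x t lam Hu)).
Qed.

Lemma trivialization_at_0 (U : R * R -> Prop) (q : R -> R -> R)
    (E : R -> R -> C -> Cmx 2 2) (lam : C) :
  is_trivialization U q E ->
  row_fst E 0 lam 0 0 = RtoC 1 /\ row_snd E 0 lam 0 0 = RtoC 0 /\
  row_fst E 1 lam 0 0 = RtoC 0 /\ row_snd E 1 lam 0 0 = RtoC 1.
Proof.
intros (_ & _ & H); unfold row_fst, row_snd; rewrite H; now repeat split.
Qed.

Lemma trivialization_det (U : R * R -> Prop) (q : R -> R -> R)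
    (E : R -> R -> C -> Cmx 2 2) (lam : C) :
  open U -> connected_set U -> U (0, 0) -> is_trivialization U q E ->
  forall x t, U (x, t) ->
    (row_fst E 0 lam x t * row_snd E 1 lam x t
     - row_snd E 0 lam x t * row_fst E 1 lam x t)%C = RtoC 1.
Proof.
intros HU Hc U0 H x t Hu.
destruct (trivialization_at_0 U q E lam H) as (I1 & I2 & I3 & I4).
rewrite (wronskian_constant U q lam _ _ _ _ HU Hc U0
  (trivialization_rows U q E lam 0 H ltac:(lia))
  (trivialization_rows U q E lam 1 H ltac:(lia)) x t Hu).
rewrite I1, I2, I3, I4; ring.
Qed.

(** Cramer's rule, the Wronskians with the rows of [E] being constant. *)
Lemma row_solution_unique (U : R * R -> Prop) (q : R -> R -> R)
    (E : R -> R -> C -> Cmx 2 2) (lam : C) (y z : R -> R -> C) :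
  open U -> connected_set U -> U (0, 0) -> is_trivialization U q E ->
  row_solution U q lam y z ->
  forall x t, U (x, t) ->
    y x t = (y 0 0 * row_fst E 0 lam x t + z 0 0 * row_fst E 1 lam x t)%C /\
    z x t = (y 0 0 * row_snd E 0 lam x t + z 0 0 * row_snd E 1 lam x t)%C.
Proof.
intros HU Hc U0 H Hyz x t Hu.
destruct (trivialization_at_0 U q E lam H) as (I1 & I2 & I3 & I4).
assert (W := trivialization_det U q E lam HU Hc U0 H x t Hu).
assert (W0 := wronskian_constant U q lam _ _ _ _ HU Hc U0 Hyz
  (trivialization_rows U q E lam 0 H ltac:(lia)) x t Hu).
assert (W1 := wronskian_constant U q lam _ _ _ _ HU Hc U0 Hyz
  (trivialization_rows U q E lam 1 H ltac:(lia)) x t Hu).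
rewrite I1, I2 in W0; rewrite I3, I4 in W1.
set (a := row_fst E 0 lam x t) in *; set (b := row_snd E 0 lam x t) in *.
set (c := row_fst E 1 lam x t) in *; set (d := row_snd E 1 lam x t) in *.
assert (Z0 : z 0 0 = (- (y x t * b - z x t * a))%C) by (rewrite W0; ring).
assert (Y0 : y 0 0 = (y x t * d - z x t * c)%C) by (rewrite W1; ring).
rewrite Z0, Y0; split.
- transitivity (y x t * (a * d - b * c))%C; [rewrite W |]; ring.
- transitivity (z x t * (a * d - b * c))%C; [rewrite W |]; ring.
Qed.

(** * Dependence of a trivialization on the spectral parameter *)

Lemma smooth_ex_derive (U : R * R -> Prop) (q : R -> R -> R) (p : nat) (x t : R) :
  smooth_on U q -> U (x, t) ->
  ex_derive (fun s => partial_derive p 0 q s t) x /\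
  ex_derive (fun s => partial_derive p 0 q x s) t.
Proof.
intros H Hu; assert (Hn := H x t Hu (S p)); split.
- apply (ex_diff_n_ex_deriv_inf_1 (S p) p 0); [lia | exact Hn].
- apply (ex_diff_n_ex_deriv_inf_2 (S p) p 0); [lia | exact Hn].
Qed.

Lemma continuous_RtoC (f : R -> R) (x : R) :
  ex_derive f x -> continuous (U := C_R_NormedModule) (fun s => RtoC (f s)) x.
Proof.
intros [l H]; eapply rderive_continuous, rderive_RtoC, H.
Qed.

Lemma continuous_Cconst (c : C) (x : R) :
  continuous (U := C_R_NormedModule) (fun _ => c) x.
Proof. eapply rderive_continuous, rderive_const. Qed.

Ltac ccont :=
  match goal with
  | |- continuous (fun _ => ?c) _ => apply continuous_Cconst
  | |- continuous (fun s => (@?f s + @?g s)%C) _ =>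
      apply (continuous_Cplus f g); ccont
  | |- continuous (fun s => (@?f s - @?g s)%C) _ =>
      apply (continuous_Cminus f g); ccont
  | |- continuous (fun s => (@?f s * @?g s)%C) _ =>
      apply (continuous_Cmult f g); ccont
  | |- continuous (fun s => RtoC (@?f s)) _ =>
      apply (continuous_RtoC f); auto_derive; tauto
  end.

Definition row_jet (E : R -> R -> C -> Cmx 2 2) (i : nat) (lam : C) (x t : R)
    (c d : C) : Prop :=
  (exists c2, jet2 (fun m => row_fst E i (lam + m)%C x t) c c2) /\
  (exists d2, jet2 (fun m => row_snd E i (lam + m)%C x t) d d2).

Definition dlax_al (q0 : R) (lam : C) : C := (3 * lam * lam - RtoC (q0 / 2))%C.
Definition dlax_be (q0 q1 : R) (lam : C) : C :=
  (2 * lam * RtoC q0 - RtoC (q1 / 2))%C.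
Definition dlax_ga (lam : C) : C := (2 * lam)%C.

(** The derivative of the two equations for the row [(y, z)] with respect to
    [lam], with [(y1, z1)] in place of the derivative of [(y, z)]. *)
Definition dual_row_x (q : R -> R -> R) (lam : C) (y z y1 z1 : R -> R -> C)
    (x t : R) : Prop :=
  rderive (fun s => y1 s t) x (y1 x t * lam + z1 x t + y x t)%C /\
  rderive (fun s => z1 s t) x
    (y1 x t * RtoC (q x t) - z1 x t * lam - z x t)%C.

Definition dual_row_t (q : R -> R -> R) (lam : C) (y z y1 z1 : R -> R -> C)
    (x t : R) : Prop :=
  let q0 := q x t in
  let q1 := partial_derive 1 0 q x t in
  let q2 := partial_derive 2 0 q x t in
  rderive (fun s => y1 x s) t
    (y1 x t * lax_al q0 q1 lam + z1 x t * lax_ga q0 lam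
     + (y x t * dlax_al q0 lam + z x t * dlax_ga lam))%C /\
  rderive (fun s => z1 x s) t
    (y1 x t * lax_be q0 q1 q2 lam - z1 x t * lax_al q0 q1 lam
     + (y x t * dlax_be q0 q1 lam - z x t * dlax_al q0 lam))%C.

(** The rows of [E] at [lam] serve as the fundamental system. *)
Lemma row_jet_step_x (U : R * R -> Prop) (q : R -> R -> R)
    (E : R -> R -> C -> Cmx 2 2) (lam : C) (i : nat) (a b t s0 : R) (c d : C) :
  open U -> connected_set U -> U (0, 0) -> smooth_on U q ->
  is_trivialization U q E -> (i < 2)%nat ->
  (forall s, a < s < b -> U (s, t)) -> a < s0 < b ->
  row_jet E i lam s0 t c d ->
  exists y1 z1 : R -> C, forall s, a < s < b ->
    row_jet E i lam s t (y1 s) (z1 s) /\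
    dual_row_x q lam (row_fst E i lam) (row_snd E i lam)
      (fun s _ => y1 s) (fun s _ => z1 s) s t.
Proof.
intros HU Hc U0 Hq HE Hi Hab Hs0 [[c2 J1] [d2 J2]].
destruct (jet_propagation a b s0
  (fun j _ => match j with O => lam | 1%nat => RtoC 1 | _ => RtoC 0 end)
  (fun j s => match j with O => RtoC (q s t) | _ => RtoC 0 end)
  (fun j _ => match j with O => RtoC 1 | _ => RtoC 0 end)
  (fun m s => row_fst E i (lam + m)%C s t) (fun m s => row_snd E i (lam + m)%C s t)
  (fun s => row_fst E 0 lam s t) (fun s => row_snd E 0 lam s t)
  (fun s => row_fst E 1 lam s t) (fun s => row_snd E 1 lam s t) c d c2 d2 Hs0)
  as (y1 & z1 & y2 & z2 & H).
- intros j s Hs; destruct (smooth_ex_derive U q 0 s t Hq (Hab s Hs)) as [D _].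
  change (ex_derive (fun s => q s t) s) in D.
  split; [| split].
  + destruct j as [| [| j]]; apply continuous_Cconst.
  + destruct j as [| j]; [now apply continuous_RtoC | apply continuous_Cconst].
  + destruct j as [| j]; apply continuous_Cconst.
- intros m s Hs.
  destruct (trivialization_rows U q E (lam + m)%C i HE Hi s t (Hab s Hs))
    as (A & B & _ & _).
  split; (eapply rderive_eq; [eassumption | unfold cubic; ring]).
- intros s Hs.
  destruct (trivialization_rows U q E lam 0 HE ltac:(lia) s t (Hab s Hs))
    as (A & B & _ & _).
  destruct (trivialization_rows U q E lam 1 HE ltac:(lia) s t (Hab s Hs))
    as (A' & B' & _ & _).
  do 4 (split; [eapply rderive_eq; [eassumption | ring] |]).
  apply (trivialization_det U q E lam HU Hc U0 HE s t (Hab s Hs)).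
- exact J1.
- exact J2.
- exists y1, z1; intros s Hs; destruct (H s Hs) as (A & B & J & J').
  split; [split; [now exists (y2 s) | now exists (z2 s)] |].
  cbv beta in A, B; replace (lam + RtoC 0)%C with lam in A, B by ring.
  split; (eapply rderive_eq; [eassumption | ring]).
Qed.

Lemma row_jet_step_t (U : R * R -> Prop) (q : R -> R -> R)
    (E : R -> R -> C -> Cmx 2 2) (lam : C) (i : nat) (a b x s0 : R) (c d : C) :
  open U -> connected_set U -> U (0, 0) -> smooth_on U q ->
  is_trivialization U q E -> (i < 2)%nat ->
  (forall s, a < s < b -> U (x, s)) -> a < s0 < b ->
  row_jet E i lam x s0 c d ->
  exists y1 z1 : R -> C, forall s, a < s < b ->
    row_jet E i lam x s (y1 s) (z1 s) /\
    dual_row_t q lam (row_fst E i lam) (row_snd E i lam)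
      (fun _ s => y1 s) (fun _ s => z1 s) x s.
Proof.
intros HU Hc U0 Hq HE Hi Hab Hs0 [[c2 J1] [d2 J2]].
destruct (jet_propagation a b s0
  (fun j s => match j with
    | O => lax_al (q x s) (partial_derive 1 0 q x s) lam
    | 1%nat => dlax_al (q x s) lam
    | 2%nat => (3 * lam)%C
    | _ => RtoC 1 end)
  (fun j s => match j with
    | O => lax_be (q x s) (partial_derive 1 0 q x s) (partial_derive 2 0 q x s) lam
    | 1%nat => dlax_be (q x s) (partial_derive 1 0 q x s) lam
    | 2%nat => RtoC (q x s)
    | _ => RtoC 0 end)
  (fun j s => match j with
    | O => lax_ga (q x s) lam
    | 1%nat => dlax_ga lam
    | 2%nat => RtoC 1
    | _ => RtoC 0 end)
  (fun m s => row_fst E i (lam + m)%C x s) (fun m s => row_snd E i (lam + m)%C x s)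
  (fun s => row_fst E 0 lam x s) (fun s => row_snd E 0 lam x s)
  (fun s => row_fst E 1 lam x s) (fun s => row_snd E 1 lam x s) c d c2 d2 Hs0)
  as (y1 & z1 & y2 & z2 & H).
- intros j s Hs.
  destruct (smooth_ex_derive U q 0 x s Hq (Hab s Hs)) as [_ D0].
  destruct (smooth_ex_derive U q 1 x s Hq (Hab s Hs)) as [_ D1].
  destruct (smooth_ex_derive U q 2 x s Hq (Hab s Hs)) as [_ D2].
  change (ex_derive (fun s => q x s) s) in D0.
  split; [| split].
  + destruct j as [| [| [| j]]]; unfold lax_al, dlax_al; ccont.
  + destruct j as [| [| [| j]]]; unfold lax_be, dlax_be; ccont.
  + destruct j as [| [| [| j]]]; unfold lax_ga, dlax_ga; ccont.
- intros m s Hs.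
  destruct (trivialization_rows U q E (lam + m)%C i HE Hi x s (Hab s Hs))
    as (_ & _ & A & B).
  split; (eapply rderive_eq; [eassumption |
    unfold cubic, lax_al, lax_be, lax_ga, dlax_al, dlax_be, dlax_ga; ring]).
- intros s Hs.
  destruct (trivialization_rows U q E lam 0 HE ltac:(lia) x s (Hab s Hs))
    as (_ & _ & A & B).
  destruct (trivialization_rows U q E lam 1 HE ltac:(lia) x s (Hab s Hs))
    as (_ & _ & A' & B').
  do 4 (split; [eassumption |]).
  apply (trivialization_det U q E lam HU Hc U0 HE x s (Hab s Hs)).
- exact J1.
- exact J2.
- exists y1, z1; intros s Hs; destruct (H s Hs) as (A & B & J & J').
  split; [split; [now exists (y2 s) | now exists (z2 s)] |].
  cbv beta in A, B; replace (lam + RtoC 0)%C with lam in A, B by ring.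
  split; assumption.
Qed.

(** At the origin the rows do not depend on [lam]. *)
Lemma row_jet_exists (U : R * R -> Prop) (q : R -> R -> R)
    (E : R -> R -> C -> Cmx 2 2) (lam : C) (i : nat) :
  open U -> connected_set U -> U (0, 0) -> smooth_on U q ->
  is_trivialization U q E -> (i < 2)%nat ->
  forall x t, U (x, t) -> exists c d, row_jet E i lam x t c d.
Proof.
intros HU Hc U0 Hq HE Hi.
apply (connected_propagation U (fun x t => exists c d, row_jet E i lam x t c d)
  HU Hc U0).
- exists (RtoC 0), (RtoC 0); split; exists (RtoC 0); exists 0, 1;
    (split; [lra |]); intros m Hm; unfold row_fst, row_snd;
    destruct HE as (_ & _ & HI); rewrite !HI;
    match goal with |- Cmod ?w <= _ => replace w with (RtoC 0) by ring end;
    rewrite Cmod_0; lra.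
- intros a b t Hab s0 s1 Hs0 Hs1 (c & d & J).
  destruct (row_jet_step_x U q E lam i a b t s0 c d HU Hc U0 Hq HE Hi Hab Hs0 J)
    as (y1 & z1 & H).
  exists (y1 s1), (z1 s1); now apply H.
- intros a b x Hab s0 s1 Hs0 Hs1 (c & d & J).
  destruct (row_jet_step_t U q E lam i a b x s0 c d HU Hc U0 Hq HE Hi Hab Hs0 J)
    as (y1 & z1 & H).
  exists (y1 s1), (z1 s1); now apply H.
Qed.

Definition drow_fst (E : R -> R -> C -> Cmx 2 2) (i : nat) (lam : C)
    (x t : R) : C := C_derive (fun w => row_fst E i w x t) lam.
Definition drow_snd (E : R -> R -> C -> Cmx 2 2) (i : nat) (lam : C)
    (x t : R) : C := C_derive (fun w => row_snd E i w x t) lam.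

Lemma row_jet_derive (E : R -> R -> C -> Cmx 2 2) (i : nat) (lam : C)
    (x t : R) (c d : C) :
  row_jet E i lam x t c d ->
  drow_fst E i lam x t = c /\ drow_snd E i lam x t = d.
Proof.
intros [[c2 J1] [d2 J2]]; split; apply is_C_derive_unique.
- exact (proj2 (jet2_divdiff (fun w => row_fst E i w x t) lam c c2 J1)).
- exact (proj2 (jet2_divdiff (fun w => row_snd E i w x t) lam d d2 J2)).
Qed.

Lemma row_divdiff (U : R * R -> Prop) (q : R -> R -> R)
    (E : R -> R -> C -> Cmx 2 2) (lam : C) (i : nat) :
  open U -> connected_set U -> U (0, 0) -> smooth_on U q ->
  is_trivialization U q E -> (i < 2)%nat ->
  forall x t, U (x, t) ->
    divdiff (fun w => row_fst E i w x t) lam /\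
    divdiff (fun w => row_snd E i w x t) lam.
Proof.
intros HU Hc U0 Hq HE Hi x t Hu.
destruct (row_jet_exists U q E lam i HU Hc U0 Hq HE Hi x t Hu)
  as (c & d & [[c2 J1] [d2 J2]]); split.
- exact (proj1 (jet2_divdiff (fun w => row_fst E i w x t) lam c c2 J1)).
- exact (proj1 (jet2_divdiff (fun w => row_snd E i w x t) lam d d2 J2)).
Qed.

Lemma rderive_ext_interval (f g : R -> C) (a b x : R) (l : C) :
  a < x < b -> (forall s, a < s < b -> f s = g s) ->
  rderive f x l -> rderive g x l.
Proof.
intros Hx H; apply (is_derive_ext_loc (V := C_R_NormedModule)).
assert (Hd : 0 < Rmin (x - a) (b - x)) by (apply Rmin_pos; lra).
exists (mkposreal _ Hd); intros s Hs.
assert (Hs' : Rabs (s - x) < Rmin (x - a) (b - x)) by exact Hs.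
apply Rabs_def2 in Hs'.
assert (M1 := Rmin_l (x - a) (b - x)); assert (M2 := Rmin_r (x - a) (b - x)).
apply H; lra.
Qed.

(** The propagated first Taylor coefficient solves the differentiated
    equations, and it is the derivative in [lam] at every point of a segment
    through [(x, t)]. *)
Lemma trivialization_dual_rows (U : R * R -> Prop) (q : R -> R -> R)
    (E : R -> R -> C -> Cmx 2 2) (lam : C) (i : nat) :
  open U -> connected_set U -> U (0, 0) -> smooth_on U q ->
  is_trivialization U q E -> (i < 2)%nat ->
  forall x t, U (x, t) ->
    dual_row_x q lam (row_fst E i lam) (row_snd E i lam)
      (drow_fst E i lam) (drow_snd E i lam) x t /\
    dual_row_t q lam (row_fst E i lam) (row_snd E i lam)
      (drow_fst E i lam) (drow_snd E i lam) x t.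
Proof.
intros HU Hc U0 Hq HE Hi x t Hu.
destruct (open_box U x t HU Hu) as (r & Pr & Hr).
destruct (row_jet_exists U q E lam i HU Hc U0 Hq HE Hi x t Hu) as (c & d & J).
assert (Hz : forall w, Rabs (w - w) < r)
  by (intros w; rewrite Rminus_diag, Rabs_R0; exact Pr).
assert (Hx : x - r < x < x + r) by lra.
assert (Ht : t - r < t < t + r) by lra.
split.
- destruct (row_jet_step_x U q E lam i (x - r) (x + r) t x c d HU Hc U0 Hq HE Hi)
    as (y1 & z1 & H); [| exact Hx | exact J |].
  { intros s Hs; apply Hr; [apply Rabs_def1; lra | apply Hz]. }
  assert (Hd : forall s, x - r < s < x + r ->
    y1 s = drow_fst E i lam s t /\ z1 s = drow_snd E i lam s t).
  { intros s Hs; destruct (H s Hs) as [J' _].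
    apply row_jet_derive in J'; split; symmetry; apply J'. }
  destruct (H x Hx) as [_ [A B]]; cbv beta in A, B.
  destruct (Hd x Hx) as [E1 E2]; rewrite E1, E2 in A, B.
  split; (eapply rderive_ext_interval; [exact Hx | | eassumption]);
    intros s Hs; apply (Hd s Hs).
- destruct (row_jet_step_t U q E lam i (t - r) (t + r) x t c d HU Hc U0 Hq HE Hi)
    as (y1 & z1 & H); [| exact Ht | exact J |].
  { intros s Hs; apply Hr; [apply Hz | apply Rabs_def1; lra]. }
  assert (Hd : forall s, t - r < s < t + r ->
    y1 s = drow_fst E i lam x s /\ z1 s = drow_snd E i lam x s).
  { intros s Hs; destruct (H s Hs) as [J' _].
    apply row_jet_derive in J'; split; symmetry; apply J'. }
  destruct (H t Ht) as [_ [A B]]; cbv beta in A, B.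
  destruct (Hd t Ht) as [E1 E2]; rewrite E1, E2 in A, B.
  split; (eapply rderive_ext_interval; [exact Ht | | eassumption]);
    intros s Hs; apply (Hd s Hs).
Qed.

(** * Functions of class C^n on an open set *)

Definition Cn_on (U : R * R -> Prop) (n : nat) (f : R -> R -> R) : Prop :=
  forall x t, U (x, t) -> ex_diff_n f n x t.

Lemma open_locally_2d (U : R * R -> Prop) (P : R -> R -> Prop) (x t : R) :
  open U -> U (x, t) -> (forall u v, U (u, v) -> P u v) -> locally_2d P x t.
Proof.
intros HU Hu HP; destruct (open_box U x t HU Hu) as (r & Pr & Hr).
exists (mkposreal r Pr); intros u v B1 B2; apply HP, Hr; assumption.
Qed.

Lemma Cn_on_ext (U : R * R -> Prop) (n : nat) (f g : R -> R -> R) :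
  open U -> (forall x t, U (x, t) -> f x t = g x t) ->
  Cn_on U n f -> Cn_on U n g.
Proof.
intros HU H Hf x t Hu.
apply (ex_diff_n_ext_loc f); [| now apply Hf].
now apply (open_locally_2d U).
Qed.

Lemma Cn_on_le (U : R * R -> Prop) (m n : nat) (f : R -> R -> R) :
  (m <= n)%nat -> Cn_on U n f -> Cn_on U m f.
Proof. intros Hmn H x t Hu; apply (ex_diff_n_m n); auto. Qed.

Lemma Cn_on_S (U : R * R -> Prop) (n : nat) (f fx ft : R -> R -> R) :
  open U ->
  (forall x t, U (x, t) -> continuity_2d_pt f x t /\
     is_derive (fun s => f s t) x (fx x t) /\
     is_derive (fun s => f x s) t (ft x t)) ->
  Cn_on U n fx -> Cn_on U n ft -> Cn_on U (S n) f.
Proof.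
intros HU H Hx Ht.
assert (Ex : Cn_on U n (fun u v => Derive (fun s => f s v) u)).
{ apply (Cn_on_ext U n fx); [exact HU | | exact Hx].
  intros x t Hu; symmetry; apply is_derive_unique; apply (H x t Hu). }
assert (Et : Cn_on U n (fun u v => Derive (fun s => f u s) v)).
{ apply (Cn_on_ext U n ft); [exact HU | | exact Ht].
  intros x t Hu; symmetry; apply is_derive_unique; apply (H x t Hu). }
intros x t Hu; destruct (H x t Hu) as (H0 & Dx & Dt).
split; [exact H0 |]; split; [eexists; exact Dx |].
split; [eexists; exact Dt |]; split; [now apply Ex | now apply Et].
Qed.

Lemma Cn_on_S_inv (U : R * R -> Prop) (n : nat) (f : R -> R -> R) :
  Cn_on U (S n) f ->
  exists fx ft, Cn_on U n fx /\ Cn_on U n ft /\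
    forall x t, U (x, t) -> continuity_2d_pt f x t /\
     is_derive (fun s => f s t) x (fx x t) /\
     is_derive (fun s => f x s) t (ft x t).
Proof.
intros H.
exists (fun u v => Derive (fun s => f s v) u), (fun u v => Derive (fun s => f u s) v).
split; [| split].
- intros x t Hu; apply (H x t Hu).
- intros x t Hu; apply (H x t Hu).
- intros x t Hu; destruct (H x t Hu) as (H0 & Dx & Dt & _).
  split; [exact H0 | split; apply Derive_correct; assumption].
Qed.

Lemma Cn_on_const (U : R * R -> Prop) (c : R) (n : nat) :
  open U -> Cn_on U n (fun _ _ => c).
Proof.
intros HU; revert c; induction n as [| n IH]; intros c.
- intros x t _; split; [apply continuity_2d_pt_const | exact I].
- apply (Cn_on_S U n _ (fun _ _ => 0) (fun _ _ => 0)); auto.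
  intros x t _; split; [apply continuity_2d_pt_const |].
  split; apply (is_derive_const (V := R_NormedModule)).
Qed.

Lemma Cn_on_plus (U : R * R -> Prop) (n : nat) (f g : R -> R -> R) :
  open U -> Cn_on U n f -> Cn_on U n g -> Cn_on U n (fun x t => f x t + g x t).
Proof.
intros HU; revert f g; induction n as [| n IH]; intros f g Hf Hg.
- intros x t Hu; split; [| exact I].
  apply continuity_2d_pt_plus; [apply (Hf x t Hu) | apply (Hg x t Hu)].
- apply Cn_on_S_inv in Hf, Hg.
  destruct Hf as (fx & ft & Fx & Ft & Hf), Hg as (gx & gt & Gx & Gt & Hg).
  apply (Cn_on_S U n _ (fun x t => fx x t + gx x t) (fun x t => ft x t + gt x t));
    auto.
  intros x t Hu; destruct (Hf x t Hu) as (F0 & F1 & F2), (Hg x t Hu) as (G0 & G1 & G2).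
  split; [now apply continuity_2d_pt_plus |].
  split; now apply (is_derive_plus (V := R_NormedModule)).
Qed.

Lemma is_derive_Rmult (f g : R -> R) (x a b : R) :
  is_derive f x a -> is_derive g x b ->
  is_derive (fun s => f s * g s) x (a * g x + f x * b).
Proof.
intros Hf Hg; apply (is_derive_mult (K := R_AbsRing) f g x a b Hf Hg).
intros; apply Rmult_comm.
Qed.

Lemma Cn_on_mult (U : R * R -> Prop) (n : nat) (f g : R -> R -> R) :
  open U -> Cn_on U n f -> Cn_on U n g -> Cn_on U n (fun x t => f x t * g x t).
Proof.
intros HU; revert f g; induction n as [| n IH]; intros f g Hf Hg.
- intros x t Hu; split; [| exact I].
  apply continuity_2d_pt_mult; [apply (Hf x t Hu) | apply (Hg x t Hu)].
- assert (Lf := Cn_on_le U n (S n) f ltac:(lia) Hf).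
  assert (Lg := Cn_on_le U n (S n) g ltac:(lia) Hg).
  apply Cn_on_S_inv in Hf, Hg.
  destruct Hf as (fx & ft & Fx & Ft & Hf), Hg as (gx & gt & Gx & Gt & Hg).
  apply (Cn_on_S U n _ (fun x t => fx x t * g x t + f x t * gx x t)
    (fun x t => ft x t * g x t + f x t * gt x t)); auto using Cn_on_plus.
  intros x t Hu; destruct (Hf x t Hu) as (F0 & F1 & F2), (Hg x t Hu) as (G0 & G1 & G2).
  split; [now apply continuity_2d_pt_mult |].
  split; [now apply (is_derive_Rmult (fun s => f s t) (fun s => g s t))
        | now apply (is_derive_Rmult (fun s => f x s) (fun s => g x s))].
Qed.

Lemma smooth_on_partial (U : R * R -> Prop) (q : R -> R -> R) (p : nat) :
  smooth_on U q -> smooth_on U (partial_derive p 0 q).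
Proof.
intros H x t Hu n.
assert (Q := ex_diff_n_deriv (n + p) p 0 ltac:(lia) q x t (H x t Hu (n + p)%nat)).
now replace (n + p - (p + 0))%nat with n in Q by lia.
Qed.

(** * The Riccati equations of the new parameter *)

Definition riccati_t (q0 q1 q2 k xi : R) : R :=
  k ^ 4 - k ^ 2 * xi ^ 2 + q0 * (k ^ 2 + xi ^ 2) / 2 - xi * q1 / 2
  + (q2 - 2 * q0 ^ 2) / 4.

Definition riccati_at (q : R -> R -> R) (k : R) (xit : R -> R -> R) (x t : R) :
    Prop :=
  is_derive (fun s => xit s t) x (q x t + k ^ 2 - xit x t ^ 2) /\
  is_derive (fun s => xit x s) t
    (riccati_t (q x t) (partial_derive 1 0 q x t) (partial_derive 2 0 q x t) k
       (xit x t)).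

Ltac cn_on :=
  match goal with
  | |- Cn_on _ _ (fun _ _ => ?c) => apply Cn_on_const; assumption
  | |- Cn_on _ _ (fun x t => @?f x t + @?g x t) =>
      apply (Cn_on_plus _ _ f g); [assumption | cn_on | cn_on]
  | |- Cn_on _ _ (fun x t => @?f x t * @?g x t) =>
      apply (Cn_on_mult _ _ f g); [assumption | cn_on | cn_on]
  | |- _ => assumption
  end.

(** Bootstrapping: both derivatives are polynomials in [xit], [q], [q_x] and
    [q_xx], hence of class C^n when [xit] is. *)
Lemma riccati_smooth (U : R * R -> Prop) (q xit : R -> R -> R) (k : R) :
  open U -> smooth_on U q ->
  (forall x t, U (x, t) -> continuity_2d_pt xit x t) ->
  (forall x t, U (x, t) -> riccati_at q k xit x t) -> smooth_on U xit.
Proof.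
intros HU Hq Hc Hr.
assert (H : forall n, Cn_on U n xit); [| intros x t Hu n; now apply H].
induction n as [| n IH].
- intros x t Hu; split; [now apply Hc | exact I].
- assert (Q0 : Cn_on U n (fun x t => q x t)) by (intros x t Hu; now apply Hq).
  assert (Q1 : Cn_on U n (fun x t => partial_derive 1 0 q x t))
    by (intros x t Hu; now apply (smooth_on_partial U q 1)).
  assert (Q2 : Cn_on U n (fun x t => partial_derive 2 0 q x t))
    by (intros x t Hu; now apply (smooth_on_partial U q 2)).
  assert (X : Cn_on U n (fun x t => xit x t)) by exact IH.
  apply (Cn_on_S U n _ (fun x t => q x t + k ^ 2 - xit x t ^ 2)
    (fun x t => riccati_t (q x t) (partial_derive 1 0 q x t)
       (partial_derive 2 0 q x t) k (xit x t)) HU).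
  + intros x t Hu; split; [now apply Hc | now apply Hr].
  + apply (Cn_on_ext U n (fun x t => q x t + k ^ 2 + (-1) * (xit x t * xit x t)));
      [exact HU | intros; ring | cn_on].
  + apply (Cn_on_ext U n (fun x t =>
      k ^ 4 + (- k ^ 2) * (xit x t * xit x t)
      + (/ 2) * (q x t * (k ^ 2 + xit x t * xit x t))
      + (- / 2) * (xit x t * partial_derive 1 0 q x t)
      + (/ 4) * (partial_derive 2 0 q x t + (-2) * (q x t * q x t))));
      [exact HU | intros; unfold riccati_t; field | cn_on].
Qed.

Ltac real_der_step :=
  match goal with
  | |- is_derive (fun _ => ?c) _ _ => apply (is_derive_const (V := R_NormedModule))
  | |- is_derive (fun s => @?f s + @?g s) _ _ =>
      apply (is_derive_plus (V := R_NormedModule) f g)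
  | |- is_derive (fun s => @?f s - @?g s) _ _ =>
      apply (is_derive_minus (V := R_NormedModule) f g)
  | |- is_derive (fun s => @?f s * @?g s) _ _ => apply (is_derive_Rmult f g)
  | |- is_derive (fun s => - @?f s) _ _ =>
      apply (is_derive_opp (V := R_NormedModule) f)
  | |- _ => eassumption
  end.

Lemma bt_q_partials (U : R * R -> Prop) (q xit : R -> R -> R) (k : R) :
  open U -> smooth_on U q ->
  (forall x t, U (x, t) -> riccati_at q k xit x t) ->
  forall x t, U (x, t) ->
  let q0 := q x t in
  let q1 := partial_derive 1 0 q x t in
  let q2 := partial_derive 2 0 q x t in
  let q3 := partial_derive 3 0 q x t in
  let w := xit x t in
  let r := q0 + k ^ 2 - w ^ 2 in
  partial_derive 1 0 (bt_q q xit k) x t = - q1 + 4 * (w * r) /\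
  partial_derive 2 0 (bt_q q xit k) x t =
    - q2 + 4 * (r * r) + 4 * (w * q1) - 8 * (w * w * r) /\
  partial_derive 3 0 (bt_q q xit k) x t =
    - q3 + 12 * (r * q1) + 4 * (w * q2) - 32 * (w * r * r)
    - 8 * (w * w * q1) + 16 * (w * w * w * r) /\
  partial_derive 0 1 (bt_q q xit k) x t =
    - partial_derive 0 1 q x t + 4 * (w * riccati_t q0 q1 q2 k w).
Proof.
intros HU Hq Hr.
assert (Hd : forall p x t, U (x, t) ->
  is_derive (fun s => partial_derive p 0 q s t) x (partial_derive (S p) 0 q x t)).
{ intros p x t Hu; apply Derive_correct, (smooth_ex_derive U q p x t Hq Hu). }
assert (Hext : forall (f g : R -> R -> R) (l : R) x t, U (x, t) ->
  (forall u v, U (u, v) -> g u v = f u v) ->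
  is_derive (fun s => f s t) x l -> Derive (fun s => g s t) x = l).
{ intros f g l x t Hu Hfg Hf; apply is_derive_unique.
  apply (is_derive_ext_loc (fun s => f s t)); [| exact Hf].
  destruct (open_box U x t HU Hu) as (d & Pd & Hbox).
  exists (mkposreal d Pd); intros s Hs; symmetry; apply Hfg, Hbox; [exact Hs |].
  rewrite Rminus_diag, Rabs_R0; exact Pd. }
assert (H1 : forall x t, U (x, t) -> partial_derive 1 0 (bt_q q xit k) x t =
  - partial_derive 1 0 q x t + 4 * (xit x t * (q x t + k ^ 2 - xit x t * xit x t))).
{ intros x t Hu; destruct (Hr x t Hu) as [R1 _].
  assert (D0 := Hd 0%nat x t Hu).
  change (is_derive (fun s => q s t) x (partial_derive 1 0 q x t)) in D0.
  apply (Hext (fun x t => - q x t + 2 * (xit x t * xit x t - k ^ 2)) (bt_q q xit k)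
    _ x t Hu).
  - intros; unfold bt_q; ring.
  - eapply is_derive_val; [repeat real_der_step |].
    unfold plus, minus, opp, zero; cbn; unfold plus, opp; cbn; ring. }
assert (H2 : forall x t, U (x, t) -> partial_derive 2 0 (bt_q q xit k) x t =
  - partial_derive 2 0 q x t
  + 4 * ((q x t + k ^ 2 - xit x t * xit x t) * (q x t + k ^ 2 - xit x t * xit x t))
  + 4 * (xit x t * partial_derive 1 0 q x t)
  - 8 * (xit x t * xit x t * (q x t + k ^ 2 - xit x t * xit x t))).
{ intros x t Hu; destruct (Hr x t Hu) as [R1 _].
  assert (D0 := Hd 0%nat x t Hu); assert (D1 := Hd 1%nat x t Hu).
  change (is_derive (fun s => q s t) x (partial_derive 1 0 q x t)) in D0.
  apply (Hext _ (partial_derive 1 0 (bt_q q xit k)) _ x t Hu H1).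
  eapply is_derive_val; [repeat real_der_step |].
  unfold plus, minus, opp, zero; cbn -[partial_derive]; unfold plus, opp; cbn -[partial_derive]; ring. }
intros x t Hu; cbv zeta.
split; [| split; [| split]].
- rewrite H1 by exact Hu; ring.
- rewrite H2 by exact Hu; ring.
- destruct (Hr x t Hu) as [R1 _].
  assert (D0 := Hd 0%nat x t Hu); assert (D1 := Hd 1%nat x t Hu);
    assert (D2 := Hd 2%nat x t Hu).
  change (is_derive (fun s => q s t) x (partial_derive 1 0 q x t)) in D0.
  apply (Hext _ (partial_derive 2 0 (bt_q q xit k)) _ x t Hu H2).
  eapply is_derive_val; [repeat real_der_step |].
  unfold plus, minus, opp, zero; cbn -[partial_derive]; unfold plus, opp; cbn -[partial_derive]; ring.
- destruct (Hr x t Hu) as [_ R1].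
  assert (D0 : is_derive (fun s => q x s) t (partial_derive 0 1 q x t)).
  { apply Derive_correct, (smooth_ex_derive U q 0 x t Hq Hu). }
  apply (is_derive_unique (fun s => bt_q q xit k x s)).
  apply (is_derive_ext (fun s => - q x s + 2 * (xit x s * xit x s - k ^ 2))).
  { intros s; unfold bt_q; change (- q x s + 2 * (xit x s * xit x s - k ^ 2) = - q x s + 2 * (xit x s ^ 2 - k ^ 2)); ring. }
  eapply is_derive_val; [repeat real_der_step |].
  unfold plus, minus, opp, zero; cbn -[partial_derive riccati_t]; unfold plus, opp; cbn -[partial_derive riccati_t]; ring.
Qed.

(** By the Riccati equations and the KdV equation of [q], both sides are the
    same polynomial in [xit] and the derivatives of [q] in [x]. *)
Lemma riccati_KdV (U : R * R -> Prop) (q xit : R -> R -> R) (k : R) :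
  open U -> KdV_solution U q ->
  (forall x t, U (x, t) -> continuity_2d_pt xit x t) ->
  (forall x t, U (x, t) -> riccati_at q k xit x t) ->
  KdV_solution U (bt_q q xit k).
Proof.
intros HU [Hq HK] Hc Hr; split.
- assert (Hx := riccati_smooth U q xit k HU Hq Hc Hr).
  intros x t Hu n; revert x t Hu.
  change (Cn_on U n (bt_q q xit k)).
  assert (Q : Cn_on U n (fun x t => q x t)) by (intros x t Hu; now apply Hq).
  assert (X : Cn_on U n (fun x t => xit x t)) by (intros x t Hu; now apply Hx).
  apply (Cn_on_ext U n (fun x t => (-1) * q x t + 2 * (xit x t * xit x t + - k ^ 2)));
    [exact HU | intros; unfold bt_q; ring | cn_on].
- intros x t Hu.
  destruct (bt_q_partials U q xit k HU Hq Hr x t Hu) as (H1 & _ & H3 & Ht).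
  rewrite H1, H3, Ht, (HK x t Hu); unfold bt_q, riccati_t; field.
Qed.

(** * Symmetries of the rows *)

Lemma row_solution_comb (U : R * R -> Prop) (q : R -> R -> R) (lam c0 c1 : C)
    (y0 z0 y1 z1 : R -> R -> C) :
  row_solution U q lam y0 z0 -> row_solution U q lam y1 z1 ->
  row_solution U q lam (fun x t => c0 * y0 x t + c1 * y1 x t)%C
    (fun x t => c0 * z0 x t + c1 * z1 x t)%C.
Proof.
intros H0 H1 x t Hu.
destruct (H0 x t Hu) as (A1 & A2 & A3 & A4), (H1 x t Hu) as (B1 & B2 & B3 & B4).
split; [| split; [| split]]; (rder; ring).
Qed.

(** Since [y_x = lam y + z], the equations in [x] amount to
    [y_xx = (lam ^ 2 + q) y], and the second component of the solution at [- lam]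
    with the same [y] is [y_x + lam y]. *)
Lemma row_solution_reflect (U : R * R -> Prop) (q : R -> R -> R) (lam : C)
    (y z : R -> R -> C) :
  row_solution U q lam y z ->
  row_solution U q (- lam)%C y (fun x t => z x t + 2 * lam * y x t)%C.
Proof.
intros H x t Hu; destruct (H x t Hu) as (A1 & A2 & A3 & A4).
split; [| split; [| split]]; rder;
  unfold lax_al, lax_be, lax_ga; push_RtoC; field.
Qed.

Lemma row_solution_conj (U : R * R -> Prop) (q : R -> R -> R) (k : R)
    (y z : R -> R -> C) :
  row_solution U q (RtoC k) y z ->
  row_solution U q (RtoC k) (fun x t => Cconj (y x t)) (fun x t => Cconj (z x t)).
Proof.
intros H x t Hu; destruct (H x t Hu) as (A1 & A2 & A3 & A4).
apply rderive_conj in A1, A2, A3, A4.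
split; [| split; [| split]]; (eapply rderive_eq; [eassumption |]);
  unfold lax_al, lax_be, lax_ga; apply injective_projections; cbn; ring.
Qed.

(** The conjugate of a row is a row solution with the same initial value. *)
Lemma trivialization_real (U : R * R -> Prop) (q : R -> R -> R)
    (E : R -> R -> C -> Cmx 2 2) (k : R) (i : nat) :
  open U -> connected_set U -> U (0, 0) -> is_trivialization U q E ->
  (i < 2)%nat ->
  forall x t, U (x, t) ->
    row_fst E i (RtoC k) x t = RtoC (Re (row_fst E i (RtoC k) x t)) /\
    row_snd E i (RtoC k) x t = RtoC (Re (row_snd E i (RtoC k) x t)).
Proof.
intros HU Hc U0 HE Hi x t Hu.
assert (Hr := trivialization_rows U q E (RtoC k) i HE Hi).
destruct (row_solution_unique U q E (RtoC k) _ _ HU Hc U0 HE Hr x t Hu) as [A1 A2].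
destruct (row_solution_unique U q E (RtoC k) _ _ HU Hc U0 HE
  (row_solution_conj U q k _ _ Hr) x t Hu) as [B1 B2].
assert (H0 : Cconj (row_fst E i (RtoC k) 0 0) = row_fst E i (RtoC k) 0 0 /\
             Cconj (row_snd E i (RtoC k) 0 0) = row_snd E i (RtoC k) 0 0).
{ destruct (trivialization_at_0 U q E (RtoC k) HE) as (I1 & I2 & I3 & I4).
  destruct i as [| [| i]]; [rewrite I1, I2 | rewrite I3, I4 | lia];
    split; apply injective_projections; cbn; ring. }
destruct H0 as [C1 C2]; rewrite C1, C2 in B1, B2.
rewrite <- A1 in B1; rewrite <- A2 in B2.
assert (Hreal : forall c : C, Cconj c = c -> c = RtoC (Re c)).
{ intros [a b] Hc'; injection Hc' as Hb; apply injective_projections; cbn; lra. }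
split; now apply Hreal.
Qed.

(** * Joint continuity of row solutions *)

Lemma lipschitz_continuity_2d (f : R -> R -> R) (x t r B : R) :
  0 < r ->
  (forall u v, Rabs (u - x) < r -> Rabs (v - t) < r ->
     (exists d, is_derive (fun s => f s v) u d /\ Rabs d <= B) /\
     (exists d, is_derive (fun s => f u s) v d /\ Rabs d <= B)) ->
  continuity_2d_pt f x t.
Proof.
intros Pr H.
assert (Hz : forall w, Rabs (w - w) < r)
  by (intros w; rewrite Rminus_diag, Rabs_R0; exact Pr).
assert (PB : 0 <= B).
{ destruct (H x t (Hz x) (Hz t)) as [(d & _ & Hd) _].
  assert (Q := Rabs_pos d); lra. }
assert (Hmvt : forall (g : R -> R) (c s : R), Rabs (s - c) < r ->
  (forall w, Rabs (w - c) < r -> exists d, is_derive g w d /\ Rabs d <= B) ->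
  Rabs (g s - g c) <= B * Rabs (s - c)).
{ intros g c s Hs Hg.
  destruct (MVT_cor4 g (Derive g) c (Rabs (s - c))) with (b := s)
    as (w & Hw & Hwc).
  - intros w Hw; destruct (Hg w) as (d & Hd & _); [lra |].
    now rewrite (is_derive_unique _ _ _ Hd).
  - apply Rle_refl.
  - rewrite Hw, Rabs_mult; apply Rmult_le_compat_r; [apply Rabs_pos |].
    destruct (Hg w) as (d & Hd & Hb); [lra |].
    now rewrite (is_derive_unique _ _ _ Hd). }
intros eps.
assert (Hd : 0 < Rmin r (eps / (2 * (B + 1)))).
{ apply Rmin_pos; [exact Pr |].
  apply Rdiv_lt_0_compat; [apply cond_pos | lra]. }
exists (mkposreal _ Hd); simpl; intros u v Hu Hv.
assert (Hu1 := Rlt_le_trans _ _ _ Hu (Rmin_l _ _)).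
assert (Hu2 := Rlt_le_trans _ _ _ Hu (Rmin_r _ _)).
assert (Hv1 := Rlt_le_trans _ _ _ Hv (Rmin_l _ _)).
assert (Hv2 := Rlt_le_trans _ _ _ Hv (Rmin_r _ _)).
assert (E1 := Hmvt (fun s => f s v) x u Hu1 (fun w Hw => proj1 (H w v Hw Hv1))).
assert (E2 := Hmvt (fun s => f x s) t v Hv1 (fun w Hw => proj2 (H x w (Hz x) Hw))).
cbv beta in E1, E2.
replace (f u v - f x t) with ((f u v - f x v) + (f x v - f x t)) by ring.
eapply Rle_lt_trans; [apply Rabs_triang |].
assert (He : B * (eps / (2 * (B + 1))) + B * (eps / (2 * (B + 1))) < eps).
{ assert (Pe := cond_pos eps).
  replace (B * (eps / (2 * (B + 1))) + B * (eps / (2 * (B + 1))))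
    with (eps * (B / (B + 1))) by (field; lra).
  assert (B / (B + 1) < 1) by (apply Rlt_div_l; lra).
  nra. }
assert (B * Rabs (u - x) <= B * (eps / (2 * (B + 1))))
  by (apply Rmult_le_compat_l; lra).
assert (B * Rabs (v - t) <= B * (eps / (2 * (B + 1))))
  by (apply Rmult_le_compat_l; lra).
lra.
Qed.

(** A solution is only separately differentiable by hypothesis; Gronwall's
    estimate bounds it near the point, hence also its two derivatives. *)
Lemma row_solution_continuous (U : R * R -> Prop) (q : R -> R -> R) (lam : C)
    (y z : R -> R -> C) :
  open U -> smooth_on U q -> row_solution U q lam y z ->
  forall x t, U (x, t) ->
    continuity_2d_pt (fun u v => Re (y u v)) x t /\
    continuity_2d_pt (fun u v => Re (z u v)) x t.
Proof.
intros HU Hq H x t Hu.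
destruct (open_box U x t HU Hu) as (r0 & Pr0 & Hr0).
assert (Hb : forall p, exists d, 0 < d /\ forall u v,
  Rabs (u - x) < d -> Rabs (v - t) < d ->
  Rabs (partial_derive p 0 q u v) <= Rabs (partial_derive p 0 q x t) + 1).
{ intros p.
  destruct (smooth_on_partial U q p Hq x t Hu 0%nat) as [Hcont _].
  destruct (Hcont (mkposreal 1 Rlt_0_1)) as [d Hd].
  exists d; split; [apply cond_pos |].
  intros u v B1 B2; specialize (Hd u v B1 B2); simpl in Hd.
  replace (partial_derive p 0 q u v) with
    ((partial_derive p 0 q u v - partial_derive p 0 q x t)
     + partial_derive p 0 q x t) by ring.
  eapply Rle_trans; [apply Rabs_triang | lra]. }
destruct (Hb 0%nat) as (d0 & Pd0 & B0), (Hb 1%nat) as (d1 & Pd1 & B1),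
  (Hb 2%nat) as (d2 & Pd2 & B2).
change (forall u v, Rabs (u - x) < d0 -> Rabs (v - t) < d0 ->
  Rabs (q u v) <= Rabs (q x t) + 1) in B0.
set (Q0 := Rabs (q x t) + 1) in *.
set (Q1 := Rabs (partial_derive 1 0 q x t) + 1) in *.
set (Q2 := Rabs (partial_derive 2 0 q x t) + 1) in *.
set (r := Rmin r0 (Rmin d0 (Rmin d1 d2))).
assert (Pr : 0 < r) by (repeat apply Rmin_pos; assumption).
assert (Hr : r <= r0 /\ r <= d0 /\ r <= d1 /\ r <= d2).
{ unfold r; assert (M1 := Rmin_l r0 (Rmin d0 (Rmin d1 d2)));
    assert (M2 := Rmin_r r0 (Rmin d0 (Rmin d1 d2)));
    assert (M3 := Rmin_l d0 (Rmin d1 d2)); assert (M4 := Rmin_r d0 (Rmin d1 d2));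
    assert (M5 := Rmin_l d1 d2); assert (M6 := Rmin_r d1 d2); lra. }
assert (PQ : 0 <= Q0 /\ 0 <= Q1 /\ 0 <= Q2).
{ unfold Q0, Q1, Q2; repeat split;
    match goal with |- 0 <= Rabs ?a + 1 => assert (W := Rabs_pos a); lra end. }
set (L := Cmod lam).
assert (PL : 0 <= L) by apply Cmod_ge_0.
pose (Ka := L * L * L + L * (Q0 / 2) + Q1 / 4).
pose (Kb := L * L * Q0 + L * (Q1 / 2) + (Q2 + 2 * (Q0 * Q0)) / 4).
pose (Kg := L * L + Q0 / 2).
assert (PK : 0 <= Ka /\ 0 <= Kb /\ 0 <= Kg).
{ assert (0 <= L * L) by now apply Rmult_le_pos.
  assert (0 <= L * L * L) by now apply Rmult_le_pos.
  assert (0 <= L * Q0) by now apply Rmult_le_pos.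
  assert (0 <= L * L * Q0) by now apply Rmult_le_pos.
  assert (0 <= L * Q1) by now apply Rmult_le_pos.
  assert (0 <= Q0 * Q0) by now apply Rmult_le_pos.
  unfold Ka, Kb, Kg; lra. }
pose (K := L + Q0 + 1 + Ka + Kb + Kg).
assert (PK' : 0 <= K) by (unfold K; lra).
(* In the box all four derivatives are bounded by a multiple of the row. *)
assert (Hrow : forall u v, Rabs (u - x) < r -> Rabs (v - t) < r ->
  exists a b c d : C,
    rderive (fun s => y s v) u a /\ rderive (fun s => z s v) u b /\
    rderive (fun s => y u s) v c /\ rderive (fun s => z u s) v d /\
    Cmod a <= K * (Cmod (y u v) + Cmod (z u v)) /\
    Cmod b <= K * (Cmod (y u v) + Cmod (z u v)) /\
    Cmod c <= K * (Cmod (y u v) + Cmod (z u v)) /\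
    Cmod d <= K * (Cmod (y u v) + Cmod (z u v))).
{ intros u v Eu Ev.
  destruct (H u v) as (A1 & A2 & A3 & A4); [apply Hr0; lra |].
  do 4 eexists; do 4 (split; [eassumption |]).
  assert (C0 := B0 u v ltac:(lra) ltac:(lra)).
  assert (C1 := B1 u v ltac:(lra) ltac:(lra)).
  assert (C2 := B2 u v ltac:(lra) ltac:(lra)).
  assert (D0 : Cmod (RtoC (q u v)) <= Q0) by now rewrite Cmod_R.
  assert (D0h : Cmod (RtoC (q u v / 2)) <= Q0 / 2)
    by (rewrite Cmod_R; unfold Rdiv; rewrite Rabs_mult, (Rabs_pos_eq (/ 2)); lra).
  assert (D1h : Cmod (RtoC (partial_derive 1 0 q u v / 2)) <= Q1 / 2)
    by (rewrite Cmod_R; unfold Rdiv; rewrite Rabs_mult, (Rabs_pos_eq (/ 2)); lra).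
  assert (D1q : Cmod (RtoC (partial_derive 1 0 q u v / 4)) <= Q1 / 4)
    by (rewrite Cmod_R; unfold Rdiv; rewrite Rabs_mult, (Rabs_pos_eq (/ 4)); lra).
  assert (D2q : Cmod (RtoC ((partial_derive 2 0 q u v - 2 * q u v ^ 2) / 4))
    <= (Q2 + 2 * (Q0 * Q0)) / 4).
  { rewrite Cmod_R; unfold Rdiv; rewrite Rabs_mult, (Rabs_pos_eq (/ 4)) by lra.
    apply Rmult_le_compat_r; [lra |].
    eapply Rle_trans; [apply Rabs_triang |]; apply Rplus_le_compat; [exact C2 |].
    rewrite Rabs_Ropp, Rabs_mult, (Rabs_pos_eq 2) by lra.
    apply Rmult_le_compat_l; [lra |]; rewrite <- RPow_abs; simpl; rewrite Rmult_1_r.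
    apply Rmult_le_compat; auto using Rabs_pos. }
  assert (DL : Cmod lam <= L) by apply Rle_refl.
  assert (Fa : Cmod (lax_al (q u v) (partial_derive 1 0 q u v) lam) <= Ka)
    by (unfold lax_al, Ka; cbound).
  assert (Fb : Cmod (lax_be (q u v) (partial_derive 1 0 q u v)
    (partial_derive 2 0 q u v) lam) <= Kb) by (unfold lax_be, Kb; cbound).
  assert (Fg : Cmod (lax_ga (q u v) lam) <= Kg) by (unfold lax_ga, Kg; cbound).
  assert (Py := Cmod_ge_0 (y u v)); assert (Pz := Cmod_ge_0 (z u v)).
  assert (Iy := Rle_refl (Cmod (y u v))); assert (Iz := Rle_refl (Cmod (z u v))).
  assert (HK : L <= K /\ Q0 <= K /\ 1 <= K /\ Ka <= K /\ Kb <= K /\ Kg <= K)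
    by (unfold K; lra).
  assert (Hmul : forall a b w, 0 <= w -> a <= b -> w * a <= w * b)
    by (intros; now apply Rmult_le_compat_l).
  destruct HK as (K1 & K2 & K3 & K4 & K5 & K6).
  assert (My := fun a Ha => Hmul a K _ Py Ha).
  assert (Mz := fun a Ha => Hmul a K _ Pz Ha).
  assert (My1 := My _ K1); assert (My2 := My _ K2); assert (My3 := My _ K3);
    assert (My4 := My _ K4); assert (My5 := My _ K5); assert (My6 := My _ K6);
    assert (Mz1 := Mz _ K1); assert (Mz2 := Mz _ K2); assert (Mz3 := Mz _ K3);
    assert (Mz4 := Mz _ K4); assert (Mz5 := Mz _ K5); assert (Mz6 := Mz _ K6).
  split; [| split; [| split]]; (eapply Rle_trans; [cbound | lra]). }
(* Hence the row is bounded in the box. *)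
set (X := exp ((4 * K + 2) * r)).
set (M := (Cmod (y x t) ^ 2 + Cmod (z x t) ^ 2) * X * X).
assert (Zx : Rabs (x - x) < r) by (rewrite Rminus_diag, Rabs_R0; exact Pr).
assert (Hseg : forall c w s, Rabs (w - c) < r -> Rmin c w <= s <= Rmax c w ->
  Rabs (s - c) < r).
{ intros c w s Hw; apply Rabs_def2 in Hw; unfold Rmin, Rmax;
    destruct (Rle_dec c w); intros; apply Rabs_def1; lra. }
assert (Hexp : forall d, Rabs d < r -> exp ((4 * K + 2) * Rabs d) <= X).
{ intros d Hd; left; apply exp_increasing, Rmult_lt_compat_l; lra. }
assert (HM : forall u v, Rabs (u - x) < r -> Rabs (v - t) < r ->
  Cmod (y u v) ^ 2 + Cmod (z u v) ^ 2 <= M).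
{ intros u v Eu Ev.
  assert (G1 := gronwall_pair (fun s => y x s) (fun s => z x s)
    (fun s => (y x s * lax_al (q x s) (partial_derive 1 0 q x s) lam
       + z x s * lax_ga (q x s) lam)%C)
    (fun s => (y x s * lax_be (q x s) (partial_derive 1 0 q x s)
       (partial_derive 2 0 q x s) lam
       - z x s * lax_al (q x s) (partial_derive 1 0 q x s) lam)%C) K 0 t v PK').
  assert (G2 := gronwall_pair (fun s => y s v) (fun s => z s v)
    (fun s => (y s v * lam + z s v)%C)
    (fun s => (y s v * RtoC (q s v) - z s v * lam)%C) K 0 x u PK').
  cbv beta in G1, G2.
  assert (Huniq : forall (f : R -> C) w a b, rderive f w a -> rderive f w b -> a = b).
  { intros f w a b Ha Hb'; apply rderive_iff in Ha, Hb'.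
    destruct Ha as [Ha1 Ha2], Hb' as [Hb1 Hb2].
    apply is_derive_unique in Ha1, Ha2, Hb1, Hb2.
    apply injective_projections; [exact (eq_trans (eq_sym Ha1) Hb1)
                                 | exact (eq_trans (eq_sym Ha2) Hb2)]. }
  assert (G1' := G1 ltac:(
    intros s Hs; assert (Es := Hseg t v s Ev Hs);
    destruct (H x s) as (_ & _ & A3 & A4); [apply Hr0; lra |];
    destruct (Hrow x s Zx Es) as (a & b & c & d & _ & _ & D3 & D4 & _ & _ & L3 & L4);
    rewrite <- (Huniq _ _ _ _ A3 D3) in L3; rewrite <- (Huniq _ _ _ _ A4 D4) in L4;
    split; [exact A3 | split; [exact A4 | split; lra]])).
  assert (G2' := G2 ltac:(
    intros s Hs; assert (Es := Hseg x u s Eu Hs);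
    destruct (H s v) as (A1 & A2 & _ & _); [apply Hr0; lra |];
    destruct (Hrow s v Es Ev) as (a & b & c & d & D1 & D2 & _ & _ & L1 & L2 & _ & _);
    rewrite <- (Huniq _ _ _ _ A1 D1) in L1; rewrite <- (Huniq _ _ _ _ A2 D2) in L2;
    split; [exact A1 | split; [exact A2 | split; lra]])).
  rewrite pow_i, !Rplus_0_r in G1', G2' by lia.
  assert (X1 := Hexp _ Eu); assert (X2 := Hexp _ Ev).
  assert (S1 := pow2_ge_0 (Cmod (y x t))); assert (S2 := pow2_ge_0 (Cmod (z x t))).
  assert (S3 := pow2_ge_0 (Cmod (y x v))); assert (S4 := pow2_ge_0 (Cmod (z x v))).
  assert (PX : 0 <= X) by (left; apply exp_pos).
  eapply Rle_trans; [exact G2' |].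
  unfold M; eapply Rle_trans; [apply Rmult_le_compat_l; [lra | exact X1] |].
  apply Rmult_le_compat_r; [exact PX |].
  eapply Rle_trans; [exact G1' |].
  apply Rmult_le_compat_l; [lra | exact X2]. }
assert (PM : 0 <= M).
{ assert (Q := HM x t Zx ltac:(rewrite Rminus_diag, Rabs_R0; exact Pr)).
  assert (S1 := pow2_ge_0 (Cmod (y x t))); assert (S2 := pow2_ge_0 (Cmod (z x t))).
  lra. }
assert (Hsum : forall u v, Rabs (u - x) < r -> Rabs (v - t) < r ->
  K * (Cmod (y u v) + Cmod (z u v)) <= K * (M + 1)).
{ intros u v Eu Ev; apply Rmult_le_compat_l; [exact PK' |].
  assert (Q := HM u v Eu Ev).
  assert (S1 := pow2_ge_0 (Cmod (y u v) - 1)); assert (S2 := pow2_ge_0 (Cmod (z u v) - 1)).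
  lra. }
assert (Hre : forall (f : R -> C) w l B, rderive f w l -> Cmod l <= B ->
  exists d, is_derive (fun s => Re (f s)) w d /\ Rabs d <= B).
{ intros f w l B Hf Hl; apply rderive_iff in Hf; exists (Re l).
  split; [apply Hf | eapply Rle_trans; [apply re_le_Cmod | exact Hl]]. }
split; apply (lipschitz_continuity_2d _ x t r (K * (M + 1)) Pr);
  intros u v Eu Ev; assert (S := Hsum u v Eu Ev);
  destruct (Hrow u v Eu Ev) as (a & b & c & d & D1 & D2 & D3 & D4 & L1 & L2 & L3 & L4);
  split; (eapply Hre; [eassumption | lra]).
Qed.

(** * The Darboux transformation of rows *)

(** The row [(y, z)] times the matrix with parameter [- w]. *)
Definition darboux_fst (w lam y z : C) : C := (y * (lam - w) + z)%C.
Definition darboux_snd (k : R) (w lam y z : C) : C :=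
  (y * (w * w - RtoC k * RtoC k) - z * (lam + w))%C.

(** The Riccati equations say that the right factor [p] satisfies
    [p_x = p L' - L p] and its analogue in [t], where [L] and [L'] are the
    coefficient matrices for the old and the new potential. *)
Lemma darboux_row (U : R * R -> Prop) (q xit : R -> R -> R) (k : R) (lam : C)
    (y z : R -> R -> C) :
  open U -> smooth_on U q ->
  (forall x t, U (x, t) -> riccati_at q k xit x t) ->
  row_solution U q lam y z ->
  row_solution U (bt_q q xit k) lam
    (fun x t => darboux_fst (RtoC (xit x t)) lam (y x t) (z x t))
    (fun x t => darboux_snd k (RtoC (xit x t)) lam (y x t) (z x t)).
Proof.
intros HU Hq Hr H x t Hu.
destruct (H x t Hu) as (A1 & A2 & A3 & A4), (Hr x t Hu) as [R1 R2].
destruct (bt_q_partials U q xit k HU Hq Hr x t Hu) as (P1 & P2 & _ & _).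
unfold row_solution_at; rewrite P1, P2.
unfold darboux_fst, darboux_snd; split; [| split; [| split]]; rder;
  unfold lax_al, lax_be, lax_ga, bt_q, riccati_t; push_RtoC; field.
Qed.

Definition darboux_dfst (w lam y z y1 z1 : C) : C :=
  (darboux_fst w lam y1 z1 + y)%C.
Definition darboux_dsnd (k : R) (w lam y z y1 z1 : C) : C :=
  (darboux_snd k w lam y1 z1 - z)%C.

(** Where the transformed row vanishes, its derivative in [lam] takes its
    place: the inhomogeneous terms of the differentiated equations are
    proportional to the row. *)
Lemma darboux_dual_row (U : R * R -> Prop) (q xit : R -> R -> R) (k : R) (lam : C)
    (y z y1 z1 : R -> R -> C) :
  open U -> smooth_on U q ->
  (forall x t, U (x, t) -> riccati_at q k xit x t) ->
  row_solution U q lam y z ->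
  (forall x t, U (x, t) ->
     dual_row_x q lam y z y1 z1 x t /\ dual_row_t q lam y z y1 z1 x t) ->
  (forall x t, U (x, t) ->
     darboux_fst (RtoC (xit x t)) lam (y x t) (z x t) = RtoC 0 /\
     darboux_snd k (RtoC (xit x t)) lam (y x t) (z x t) = RtoC 0) ->
  row_solution U (bt_q q xit k) lam
    (fun x t => darboux_dfst (RtoC (xit x t)) lam (y x t) (z x t) (y1 x t) (z1 x t))
    (fun x t => darboux_dsnd k (RtoC (xit x t)) lam (y x t) (z x t) (y1 x t) (z1 x t)).
Proof.
intros HU Hq Hr H Hd H0 x t Hu.
destruct (H x t Hu) as (A1 & A2 & A3 & A4), (Hr x t Hu) as [R1 R2].
destruct (Hd x t Hu) as [[D1 D2] [D3 D4]], (H0 x t Hu) as [Z1 Z2].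
destruct (bt_q_partials U q xit k HU Hq Hr x t Hu) as (P1 & P2 & _ & _).
unfold row_solution_at; rewrite P1, P2.
set (q0 := bt_q q xit k x t).
match type of P1 with _ = ?v => set (q1 := v) end.
match type of P2 with _ = ?v => set (q2 := v) end.
unfold darboux_dfst, darboux_dsnd.
set (a := darboux_fst (RtoC (xit x t)) lam (y x t) (z x t)) in *.
set (b := darboux_snd k (RtoC (xit x t)) lam (y x t) (z x t)) in *.
set (Y := (darboux_fst (RtoC (xit x t)) lam (y1 x t) (z1 x t) + y x t)%C).
set (Z := (darboux_snd k (RtoC (xit x t)) lam (y1 x t) (z1 x t) - z x t)%C).
split; [| split; [| split]].
- apply (rderive_eq _ _ _ (Y * lam + Z + a)%C); [| rewrite Z1; ring].
  unfold darboux_fst; rder.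
  unfold Y, Z, a, darboux_fst, darboux_snd; push_RtoC; field.
- apply (rderive_eq _ _ _ (Y * RtoC q0 - Z * lam - b)%C); [| rewrite Z2; ring].
  unfold darboux_snd; rder.
  unfold Y, Z, b, darboux_fst, darboux_snd, q0, bt_q; push_RtoC; field.
- apply (rderive_eq _ _ _ (Y * lax_al q0 q1 lam + Z * lax_ga q0 lam
    + (a * dlax_al q0 lam + b * dlax_ga lam))%C); [| rewrite Z1, Z2; ring].
  unfold darboux_fst; rder.
  unfold Y, Z, a, b, darboux_fst, darboux_snd, q0, q1, lax_al, lax_be, lax_ga, dlax_al,
    dlax_be, dlax_ga, bt_q, riccati_t; push_RtoC; field.
- apply (rderive_eq _ _ _ (Y * lax_be q0 q1 q2 lam - Z * lax_al q0 q1 lam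
    + (a * dlax_be q0 q1 lam - b * dlax_al q0 lam))%C); [| rewrite Z1, Z2; ring].
  unfold darboux_snd; rder.
  unfold Y, Z, a, b, darboux_fst, darboux_snd, q0, q1, q2, lax_al, lax_be, lax_ga, dlax_al,
    dlax_be, dlax_ga, bt_q, riccati_t; push_RtoC; field.
Qed.

Lemma row_solution_ext (U : R * R -> Prop) (q : R -> R -> R) (lam : C)
    (y z y' z' : R -> R -> C) :
  open U -> (forall x t, U (x, t) -> y x t = y' x t /\ z x t = z' x t) ->
  row_solution U q lam y z -> row_solution U q lam y' z'.
Proof.
intros HU He H x t Hu.
destruct (open_box U x t HU Hu) as (r & Pr & Hr).
assert (Hz : forall w, Rabs (w - w) < r)
  by (intros w; rewrite Rminus_diag, Rabs_R0; exact Pr).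
assert (HX : forall s, x - r < s < x + r -> U (s, t))
  by (intros s Hs; apply Hr; [apply Rabs_def1; lra | apply Hz]).
assert (HT : forall s, t - r < s < t + r -> U (x, s))
  by (intros s Hs; apply Hr; [apply Hz | apply Rabs_def1; lra]).
destruct (H x t Hu) as (A1 & A2 & A3 & A4).
unfold row_solution_at.
destruct (He x t Hu) as [<- <-].
split; [| split; [| split]].
- apply (rderive_ext_interval (fun s => y s t) _ (x - r) (x + r));
    [lra | intros s Hs; apply He, HX, Hs | exact A1].
- apply (rderive_ext_interval (fun s => z s t) _ (x - r) (x + r));
    [lra | intros s Hs; apply He, HX, Hs | exact A2].
- apply (rderive_ext_interval (fun s => y x s) _ (t - r) (t + r));
    [lra | intros s Hs; apply He, HT, Hs | exact A3].
- apply (rderive_ext_interval (fun s => z x s) _ (t - r) (t + r));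
    [lra | intros s Hs; apply He, HT, Hs | exact A4].
Qed.

Lemma dual_row_comb (q : R -> R -> R) (lam c0 c1 e0 e1 : C)
    (y0 z0 y1 z1 dy0 dz0 dy1 dz1 : R -> R -> C) (x t : R) :
  row_solution_at q lam y0 z0 x t -> row_solution_at q lam y1 z1 x t ->
  dual_row_x q lam y0 z0 dy0 dz0 x t /\ dual_row_t q lam y0 z0 dy0 dz0 x t ->
  dual_row_x q lam y1 z1 dy1 dz1 x t /\ dual_row_t q lam y1 z1 dy1 dz1 x t ->
  let y := fun x t => (c0 * y0 x t + c1 * y1 x t)%C in
  let z := fun x t => (c0 * z0 x t + c1 * z1 x t)%C in
  let dy := fun x t =>
    (c0 * dy0 x t + c1 * dy1 x t + (e0 * y0 x t + e1 * y1 x t))%C in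
  let dz := fun x t =>
    (c0 * dz0 x t + c1 * dz1 x t + (e0 * z0 x t + e1 * z1 x t))%C in
  dual_row_x q lam y z dy dz x t /\ dual_row_t q lam y z dy dz x t.
Proof.
intros (A1 & A2 & A3 & A4) (B1 & B2 & B3 & B4) [[C1 C2] [C3 C4]]
  [[D1 D2] [D3 D4]] y z dy dz; unfold y, z, dy, dz.
split; split; (rder; ring).
Qed.

(** * The Baecklund transformation *)

(** The row [(1, xi - k) E(k)], which is [(f_2, - f_1)] since [det E = 1]. *)
Definition spec_fst (E : R -> R -> C -> Cmx 2 2) (xi k x t : R) : C :=
  (RtoC 1 * row_fst E 0 (RtoC k) x t + RtoC (xi - k) * row_fst E 1 (RtoC k) x t)%C.
Definition spec_snd (E : R -> R -> C -> Cmx 2 2) (xi k x t : R) : C :=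
  (RtoC 1 * row_snd E 0 (RtoC k) x t + RtoC (xi - k) * row_snd E 1 (RtoC k) x t)%C.

Definition new_parameter (E : R -> R -> C -> Cmx 2 2) (xi k x t : R) : R :=
  k + Re (spec_snd E xi k x t) / Re (spec_fst E xi k x t).

Lemma entry_mx2 (a b c d : C) :
  entry (mx2 a b c d) 0 0 = a /\ entry (mx2 a b c d) 0 1 = b /\
  entry (mx2 a b c d) 1 0 = c /\ entry (mx2 a b c d) 1 1 = d.
Proof. now repeat split. Qed.

Lemma bt_f_spec (E : R -> R -> C -> Cmx 2 2) (xi k x t : R) :
  (row_fst E 0 (RtoC k) x t * row_snd E 1 (RtoC k) x t
   - row_snd E 0 (RtoC k) x t * row_fst E 1 (RtoC k) x t)%C = RtoC 1 ->
  bt_f2 E xi k x t = spec_fst E xi k x t /\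
  bt_f1 E xi k x t = (- spec_snd E xi k x t)%C.
Proof.
intros W.
assert (Hdet : mxdet2 (E x t (RtoC k)) = RtoC 1) by exact W.
unfold bt_f1, bt_f2, bt_f, mxinv2, spec_fst, spec_snd, row_fst, row_snd.
rewrite Hdet, !entry_mul, !entry_scal by lia.
set (e := E x t (RtoC k)).
destruct (entry_mx2 (entry e 1 1) (- entry e 0 1) (- entry e 1 0) (entry e 0 0))
  as (M00 & M01 & M10 & M11).
rewrite M00, M01, M10, M11.
change (entry (cv2 (RtoC (k - xi)) (RtoC 1)) 0 0) with (RtoC (k - xi)).
change (entry (cv2 (RtoC (k - xi)) (RtoC 1)) 1 0) with (RtoC 1).
split; push_RtoC; field.
Qed.

(** ** The new parameter *)

Lemma spec_row (U : R * R -> Prop) (q : R -> R -> R)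
    (E : R -> R -> C -> Cmx 2 2) (xi k : R) :
  is_trivialization U q E ->
  row_solution U q (RtoC k) (spec_fst E xi k) (spec_snd E xi k).
Proof.
intros HE; apply row_solution_comb; apply (trivialization_rows U); auto.
Qed.

Lemma spec_real (U : R * R -> Prop) (q : R -> R -> R)
    (E : R -> R -> C -> Cmx 2 2) (xi k : R) :
  open U -> connected_set U -> U (0, 0) -> is_trivialization U q E ->
  forall x t, U (x, t) ->
    spec_fst E xi k x t = RtoC (Re (spec_fst E xi k x t)) /\
    spec_snd E xi k x t = RtoC (Re (spec_snd E xi k x t)).
Proof.
intros HU Hc U0 HE x t Hu.
destruct (trivialization_real U q E k 0 HU Hc U0 HE ltac:(lia) x t Hu) as [A0 B0].
destruct (trivialization_real U q E k 1 HU Hc U0 HE ltac:(lia) x t Hu) as [A1 B1].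
unfold spec_fst, spec_snd; rewrite A0, A1, B0, B1.
split; apply injective_projections; cbn; ring.
Qed.

Section NewParameter.

Variables (U Om : R * R -> Prop) (q : R -> R -> R)
  (E : R -> R -> C -> Cmx 2 2) (xi k : R).
Hypotheses (U_open : open U) (U_connected : connected_set U) (U_0 : U (0, 0))
  (q_smooth : smooth_on U q) (E_triv : is_trivialization U q E)
  (k_neq0 : k <> 0) (Om_open : open Om) (Om_sub : forall p, Om p -> U p)
  (f2_neq0 : forall x t, Om (x, t) -> spec_fst E xi k x t <> RtoC 0).

Let xit := new_parameter E xi k.

Lemma Re_spec_neq0 (x t : R) : Om (x, t) -> Re (spec_fst E xi k x t) <> 0.
Proof.
intros Ho H; apply (f2_neq0 x t Ho).
rewrite (proj1 (spec_real U q E xi k U_open U_connected U_0 E_triv x t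
  (Om_sub _ Ho))), H; reflexivity.
Qed.

Lemma spec_snd_eq (x t : R) : Om (x, t) ->
  spec_snd E xi k x t = ((RtoC (xit x t) - RtoC k) * spec_fst E xi k x t)%C.
Proof.
intros Ho; assert (Hn := Re_spec_neq0 x t Ho).
destruct (spec_real U q E xi k U_open U_connected U_0 E_triv x t (Om_sub _ Ho))
  as [A B].
rewrite A, B at 1; rewrite <- RtoC_minus, <- RtoC_mult; f_equal.
unfold xit, new_parameter; field; exact Hn.
Qed.

Lemma new_parameter_riccati (x t : R) : Om (x, t) -> riccati_at q k xit x t.
Proof.
intros Ho; assert (Hn := Re_spec_neq0 x t Ho).
destruct (spec_real U q E xi k U_open U_connected U_0 E_triv x t (Om_sub _ Ho))
  as [A B].
destruct (spec_row U q E xi k E_triv x t (Om_sub _ Ho)) as (D1 & D2 & D3 & D4).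
rewrite A, B in D1, D2, D3, D4.
apply rderive_iff in D1, D2, D3, D4.
destruct D1 as [D1 _], D2 as [D2 _], D3 as [D3 _], D4 as [D4 _].
assert (Hq : forall f g : R -> R, forall s a b v : R,
  is_derive f s a -> is_derive g s b -> g s <> 0 ->
  (a * g s - f s * b) / g s ^ 2 = v -> is_derive (fun s => k + f s / g s) s v).
{ intros f g s a b v Hf Hg H0 Hv.
  eapply is_derive_val.
  - apply (is_derive_plus (V := R_NormedModule) (fun _ => k) (fun s => f s / g s)).
    + apply (is_derive_const (V := R_NormedModule)).
    + apply is_derive_div; [exact Hf | exact Hg | exact H0].
  - unfold plus, zero; cbn; rewrite Rplus_0_l; exact Hv. }
split.
- apply (Hq _ _ x _ _ _ D2 D1 Hn).
  unfold xit, new_parameter.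
  set (f := Re (spec_fst E xi k x t)) in *.
  set (g := Re (spec_snd E xi k x t)) in *.
  clearbody f g; cbn -[pow]; field; exact Hn.
- apply (Hq _ _ t _ _ _ D4 D3 Hn).
  unfold riccati_t, lax_al, lax_be, lax_ga, xit, new_parameter.
  set (f := Re (spec_fst E xi k x t)) in *.
  set (g := Re (spec_snd E xi k x t)) in *.
  set (q1 := partial_derive 1 0 q x t); set (q2 := partial_derive 2 0 q x t).
  clearbody f g q1 q2; cbn; field; exact Hn.
Qed.

Lemma new_parameter_continuous (x t : R) :
  Om (x, t) -> continuity_2d_pt xit x t.
Proof.
intros Ho.
destruct (row_solution_continuous U q (RtoC k) _ _ U_open q_smooth
  (spec_row U q E xi k E_triv) x t (Om_sub _ Ho)) as [C1 C2].
apply continuity_2d_pt_plus; [apply continuity_2d_pt_const |].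
apply continuity_2d_pt_mult; [exact C2 |].
apply continuity_2d_pt_inv; [exact C1 | now apply Re_spec_neq0].
Qed.

(** ** The numerator of the transformed trivialization *)

(** The rows of [p_{xi,k}(lam)] and their derivatives in [lam]. *)
Definition left_coef (i j : nat) (lam : C) : C := entry (bt_p xi k lam) i j.
Definition dleft_coef (i j : nat) : C :=
  match i, j with
  | O, O => RtoC 1 | S _, S _ => RtoC (-1) | _, _ => RtoC 0
  end.

Definition left_fst (i : nat) (lam : C) (x t : R) : C :=
  (left_coef i 0 lam * row_fst E 0 lam x t
   + left_coef i 1 lam * row_fst E 1 lam x t)%C.
Definition left_snd (i : nat) (lam : C) (x t : R) : C :=
  (left_coef i 0 lam * row_snd E 0 lam x t
   + left_coef i 1 lam * row_snd E 1 lam x t)%C.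

Definition num_fst (i : nat) (x t : R) (lam : C) : C :=
  darboux_fst (RtoC (xit x t)) lam (left_fst i lam x t) (left_snd i lam x t).
Definition num_snd (i : nat) (x t : R) (lam : C) : C :=
  darboux_snd k (RtoC (xit x t)) lam (left_fst i lam x t) (left_snd i lam x t).

Definition new_E (x t : R) (lam : C) : Cmx 2 2 :=
  mx2 (pole_quotient k (num_fst 0 x t) lam) (pole_quotient k (num_snd 0 x t) lam)
      (pole_quotient k (num_fst 1 x t) lam) (pole_quotient k (num_snd 1 x t) lam).

Lemma entry_num (i : nat) (x t : R) (lam : C) : (i < 2)%nat ->
  entry (mxmul (mxmul (bt_p xi k lam) (E x t lam)) (bt_p (- xit x t) k lam)) i 0
    = num_fst i x t lam /\
  entry (mxmul (mxmul (bt_p xi k lam) (E x t lam)) (bt_p (- xit x t) k lam)) i 1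
    = num_snd i x t lam.
Proof.
intros Hi; rewrite !entry_mul by lia.
unfold num_fst, num_snd, darboux_fst, darboux_snd, left_fst, left_snd, left_coef,
  row_fst, row_snd.
set (p := bt_p xi k lam); set (e := E x t lam).
destruct (entry_mx2 (lam + RtoC (- xit x t)) (RtoC ((- xit x t) ^ 2 - k ^ 2))
  (RtoC 1) (- lam + RtoC (- xit x t))) as (M00 & M01 & M10 & M11).
unfold bt_p; rewrite M00, M01, M10, M11.
split; push_RtoC; ring.
Qed.

Lemma new_E_eq (x t : R) (lam : C) :
  lam <> RtoC k -> lam <> RtoC (- k) -> new_E x t lam = bt_E E xit xi k x t lam.
Proof.
intros H1 H2.
assert (Hn : (lam * lam)%C <> RtoC (k ^ 2)).
{ intros H; destruct (Cmult_integral (lam - RtoC k) (lam - RtoC (- k))) as [Hk | Hk].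
  - rewrite RtoC_opp; transitivity (lam * lam - RtoC k * RtoC k)%C; [ring |].
    rewrite H; push_RtoC; ring.
  - now apply H1, Ceq_minus.
  - now apply H2, Ceq_minus. }
unfold bt_E, new_E, pole_quotient.
destruct (excluded_middle_informative _); [contradiction |].
destruct (entry_num 0 x t lam ltac:(lia)) as [<- <-].
destruct (entry_num 1 x t lam ltac:(lia)) as [<- <-].
reflexivity.
Qed.

Lemma left_row (i : nat) (lam : C) :
  row_solution U q lam (left_fst i lam) (left_snd i lam).
Proof.
apply row_solution_comb; apply (trivialization_rows U); auto.
Qed.

(** The residues vanish.  At [k] both rows of [p E] are multiples of the
    spectral row, which the right factor annihilates; at [- k] the symmetry
    [lam -> - lam] of the equations turns the spectral row into the one that
    both rows of [p E] are multiples of. *)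
Lemma num_zero (i : nat) (x t : R) (lam : C) :
  Om (x, t) -> (i < 2)%nat -> (lam * lam)%C = RtoC (k ^ 2) ->
  num_fst i x t lam = RtoC 0 /\ num_snd i x t lam = RtoC 0.
Proof.
intros Ho Hi Hlam.
assert (Hu := Om_sub _ Ho).
assert (S := spec_snd_eq x t Ho).
assert (Hl : lam = RtoC k \/ lam = (- RtoC k)%C).
{ destruct (Cmult_integral (lam - RtoC k) (lam - - RtoC k)) as [Hk | Hk].
  - transitivity (lam * lam - RtoC k * RtoC k)%C; [ring |].
    rewrite Hlam; push_RtoC; ring.
  - left; now apply Ceq_minus.
  - right; now apply Ceq_minus. }
set (w := RtoC (xit x t)) in *.
destruct (entry_mx2 (lam + RtoC xi) (RtoC (xi ^ 2 - k ^ 2)) (RtoC 1)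
  (- lam + RtoC xi)) as (P00 & P01 & P10 & P11).
destruct Hl as [-> | ->].
- assert (Hm : exists m : C, left_fst i (RtoC k) x t = (m * spec_fst E xi k x t)%C /\
    left_snd i (RtoC k) x t = (m * spec_snd E xi k x t)%C).
  { unfold left_fst, left_snd, left_coef, bt_p, spec_fst, spec_snd.
    destruct i as [| [| i]]; [| | lia].
    - exists (RtoC k + RtoC xi)%C; rewrite P00, P01; split; push_RtoC; ring.
    - exists (RtoC 1); rewrite P10, P11; split; push_RtoC; ring. }
  destruct Hm as (m & Hf & Hs).
  unfold num_fst, num_snd, darboux_fst, darboux_snd; fold w.
  rewrite Hf, Hs, S; split; ring.
- assert (Hrow := row_solution_reflect U q (RtoC k) _ _ (spec_row U q E xi k E_triv)).
  destruct (row_solution_unique U q E (- RtoC k)%C _ _ U_open U_connected U_0 E_triv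
    Hrow x t Hu) as [F1 F2].
  destruct (trivialization_at_0 U q E (RtoC k) E_triv) as (I1 & I2 & I3 & I4).
  assert (S1 : spec_fst E xi k 0 0 = RtoC 1)
    by (unfold spec_fst; rewrite I1, I3; ring).
  assert (S2 : spec_snd E xi k 0 0 = RtoC (xi - k))
    by (unfold spec_snd; rewrite I2, I4; ring).
  rewrite S1, S2 in F1, F2.
  assert (Hm : exists m : C,
    left_fst i (- RtoC k) x t = (m * spec_fst E xi k x t)%C /\
    left_snd i (- RtoC k) x t =
      (m * (spec_snd E xi k x t + 2 * RtoC k * spec_fst E xi k x t))%C).
  { unfold left_fst, left_snd, left_coef, bt_p.
    destruct i as [| [| i]]; [| | lia].
    - exists (RtoC xi - RtoC k)%C; rewrite P00, P01;
        split; [rewrite F1 | rewrite F2]; push_RtoC; ring.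
    - exists (RtoC 1); rewrite P10, P11;
        split; [rewrite F1 | rewrite F2]; push_RtoC; ring. }
  destruct Hm as (m & Hf & Hs).
  unfold num_fst, num_snd, darboux_fst, darboux_snd; fold w.
  rewrite Hf, Hs, S; split; ring.
Qed.

Lemma num_divdiff (i : nat) (x t : R) (lam : C) :
  Om (x, t) -> (i < 2)%nat ->
  divdiff (num_fst i x t) lam /\ divdiff (num_snd i x t) lam.
Proof.
intros Ho Hi; assert (Hu := Om_sub _ Ho).
destruct (row_divdiff U q E lam 0 U_open U_connected U_0 q_smooth E_triv
  ltac:(lia) x t Hu) as [A0 B0].
destruct (row_divdiff U q E lam 1 U_open U_connected U_0 q_smooth E_triv
  ltac:(lia) x t Hu) as [A1 B1].
assert (Hco : forall j, (j < 2)%nat -> divdiff (left_coef i j) lam).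
{ intros j Hj.
  destruct i as [| [| i]], j as [| [| j]]; try lia.
  - apply (divdiff_plus (fun w => w) (fun _ => RtoC xi));
      [apply divdiff_id | apply divdiff_const].
  - apply (divdiff_const (RtoC (xi ^ 2 - k ^ 2))).
  - apply (divdiff_const (RtoC 1)).
  - destruct (divdiff_minus (fun _ => RtoC xi) (fun w => w) lam
      (divdiff_const _ _) (divdiff_id _)) as (g & Hg & Eg).
    exists g; split; [exact Hg |]; intros w; generalize (Eg w).
    unfold left_coef; change (entry (bt_p xi k ?v) 1 1) with (- v + RtoC xi)%C.
    intros Ew; rewrite (Cplus_comm (- w)), (Cplus_comm (- lam)); exact Ew. }
assert (C0 := Hco 0%nat ltac:(lia)); assert (C1 := Hco 1%nat ltac:(lia)).
assert (L1 : divdiff (fun w => left_fst i w x t) lam)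
  by (apply divdiff_plus; apply divdiff_mult; assumption).
assert (L2 : divdiff (fun w => left_snd i w x t) lam)
  by (apply divdiff_plus; apply divdiff_mult; assumption).
assert (V := divdiff_id lam).
unfold num_fst, num_snd, darboux_fst, darboux_snd; split.
- apply divdiff_plus; [apply divdiff_mult |]; [exact L1 | | exact L2].
  apply divdiff_minus; [exact V | apply divdiff_const].
- apply divdiff_minus; apply divdiff_mult;
    [exact L1 | apply divdiff_const | exact L2 |].
  apply divdiff_plus; [exact V | apply divdiff_const].
Qed.

Definition dleft_fst (i : nat) (lam : C) (x t : R) : C :=
  (left_coef i 0 lam * drow_fst E 0 lam x t + left_coef i 1 lam * drow_fst E 1 lam x t
   + (dleft_coef i 0 * row_fst E 0 lam x t + dleft_coef i 1 * row_fst E 1 lam x t))%C.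
Definition dleft_snd (i : nat) (lam : C) (x t : R) : C :=
  (left_coef i 0 lam * drow_snd E 0 lam x t + left_coef i 1 lam * drow_snd E 1 lam x t
   + (dleft_coef i 0 * row_snd E 0 lam x t + dleft_coef i 1 * row_snd E 1 lam x t))%C.

Lemma num_derive (i : nat) (x t : R) (lam : C) :
  U (x, t) -> (i < 2)%nat ->
  C_derive (num_fst i x t) lam =
    darboux_dfst (RtoC (xit x t)) lam (left_fst i lam x t) (left_snd i lam x t)
      (dleft_fst i lam x t) (dleft_snd i lam x t) /\
  C_derive (num_snd i x t) lam =
    darboux_dsnd k (RtoC (xit x t)) lam (left_fst i lam x t) (left_snd i lam x t)
      (dleft_fst i lam x t) (dleft_snd i lam x t).
Proof.
intros Hu Hi.
assert (Hrow : forall j, (j < 2)%nat ->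
  cderive (fun w => row_fst E j w x t) lam (drow_fst E j lam x t) /\
  cderive (fun w => row_snd E j w x t) lam (drow_snd E j lam x t)).
{ intros j Hj; destruct E_triv as (_ & HE & _).
  split; apply (C_derive_correct _ _ lam); apply (HE x t Hu j); lia. }
destruct (Hrow 0%nat ltac:(lia)) as [A0 B0], (Hrow 1%nat ltac:(lia)) as [A1 B1].
assert (Hco : forall j, (j < 2)%nat -> cderive (left_coef i j) lam (dleft_coef i j)).
{ intros j Hj; destruct i as [| [| i]], j as [| [| j]]; try lia; unfold left_coef.
  - apply (cderive_ext (fun w => w + RtoC xi)%C); [reflexivity | cder; cbn; ring].
  - apply (cderive_const (RtoC (xi ^ 2 - k ^ 2))).
  - apply (cderive_const (RtoC 1)).
  - apply (cderive_ext (fun w => - w + RtoC xi)%C); [reflexivity |].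
    cder; unfold dleft_coef; ring. }
assert (C0 := Hco 0%nat ltac:(lia)); assert (C1 := Hco 1%nat ltac:(lia)).
assert (L1 : cderive (fun w => left_fst i w x t) lam (dleft_fst i lam x t))
  by (unfold left_fst; cder; unfold dleft_fst; ring).
assert (L2 : cderive (fun w => left_snd i w x t) lam (dleft_snd i lam x t))
  by (unfold left_snd; cder; unfold dleft_snd; ring).
split; apply is_C_derive_unique; unfold num_fst, num_snd, darboux_fst, darboux_snd;
  cder; unfold darboux_dfst, darboux_dsnd, darboux_fst, darboux_snd; ring.
Qed.

Lemma new_E_rows (i : nat) (lam : C) : (i < 2)%nat ->
  row_solution Om (bt_q q xit k) lam
    (fun x t => pole_quotient k (num_fst i x t) lam)
    (fun x t => pole_quotient k (num_snd i x t) lam).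
Proof.
intros Hi.
assert (Om_smooth : smooth_on Om q) by (intros x t Ho; now apply q_smooth, Om_sub).
assert (Hleft : row_solution Om q lam (left_fst i lam) (left_snd i lam))
  by (intros x t Ho; apply left_row, Om_sub, Ho).
unfold pole_quotient.
destruct (excluded_middle_informative ((lam * lam)%C = RtoC (k ^ 2))) as [e | n].
- assert (Hrow := darboux_dual_row Om q xit k lam _ _
    (dleft_fst i lam) (dleft_snd i lam) Om_open Om_smooth new_parameter_riccati Hleft).
  assert (Hrow' := Hrow ltac:(
    intros x t Ho; assert (Hu := Om_sub _ Ho);
    apply dual_row_comb;
      [ apply (trivialization_rows U q E lam 0 E_triv ltac:(lia) x t Hu)
      | apply (trivialization_rows U q E lam 1 E_triv ltac:(lia) x t Hu)
      | apply (trivialization_dual_rows U q E lam 0); auto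
      | apply (trivialization_dual_rows U q E lam 1); auto ])
    ltac:(intros x t Ho; apply num_zero; assumption)).
  apply (row_solution_ext Om _ _ _ _ _ _ Om_open) with
    (2 := row_solution_comb Om _ lam (/ (2 * lam))%C (RtoC 0) _ _ _ _ Hrow' Hrow').
  intros x t Ho; destruct (num_derive i x t lam (Om_sub _ Ho) Hi) as [-> ->].
  split; unfold Cdiv; ring.
- assert (Hrow := darboux_row Om q xit k lam _ _ Om_open Om_smooth
    new_parameter_riccati Hleft).
  apply (row_solution_ext Om _ _ _ _ _ _ Om_open) with
    (2 := row_solution_comb Om _ lam (/ (lam * lam - RtoC (k ^ 2)))%C (RtoC 0)
            _ _ _ _ Hrow Hrow).
  intros x t Ho; unfold num_fst, num_snd; split; ring.
Qed.

Lemma new_E_entire (x t : R) : Om (x, t) -> mx_entire (new_E x t).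
Proof.
intros Ho.
assert (H : forall i, (i < 2)%nat -> forall lam,
  ex_cderive (pole_quotient k (num_fst i x t)) lam /\
  ex_cderive (pole_quotient k (num_snd i x t)) lam).
{ intros i Hi lam; destruct (num_divdiff i x t lam Ho Hi) as [D1 D2].
  split; apply pole_quotient_derivable; auto.
  - destruct D1 as (g & Hg & Eg); eexists; now apply (divdiff_derive _ g).
  - intros e; split; [now apply num_zero | exact D1].
  - destruct D2 as (g & Hg & Eg); eexists; now apply (divdiff_derive _ g).
  - intros e; split; [now apply num_zero | exact D2]. }
intros i j Hi Hj lam.
destruct i as [| [| i]], j as [| [| j]]; try lia.
- exact (proj1 (H 0%nat ltac:(lia) lam)).
- exact (proj2 (H 0%nat ltac:(lia) lam)).
- exact (proj1 (H 1%nat ltac:(lia) lam)).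
- exact (proj2 (H 1%nat ltac:(lia) lam)).
Qed.

Lemma new_E_at_0 (lam : C) : new_E 0 0 lam = Mone.
Proof.
assert (Hxi : RtoC (xit 0 0) = RtoC xi).
{ f_equal; unfold xit, new_parameter, spec_fst, spec_snd.
  destruct (trivialization_at_0 U q E (RtoC k) E_triv) as (-> & -> & -> & ->).
  cbn; field. }
assert (Hnum : forall w,
  num_fst 0 0 0 w = (w * w - RtoC (k ^ 2))%C /\ num_snd 0 0 0 w = RtoC 0 /\
  num_fst 1 0 0 w = RtoC 0 /\ num_snd 1 0 0 w = (w * w - RtoC (k ^ 2))%C).
{ intros w.
  destruct (entry_mx2 (w + RtoC xi) (RtoC (xi ^ 2 - k ^ 2)) (RtoC 1) (- w + RtoC xi))
    as (P00 & P01 & P10 & P11).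
  destruct (trivialization_at_0 U q E w E_triv) as (I1 & I2 & I3 & I4).
  unfold num_fst, num_snd, left_fst, left_snd, left_coef, darboux_fst, darboux_snd, bt_p.
  rewrite Hxi, I1, I2, I3, I4, P00, P01, P10, P11.
  repeat split; push_RtoC; ring. }
assert (H1 : forall f, (forall w, f w = (w * w - RtoC (k ^ 2))%C) ->
  pole_quotient k f lam = RtoC 1).
{ intros f Hf; unfold pole_quotient.
  destruct (excluded_middle_informative ((lam * lam)%C = RtoC (k ^ 2))) as [e | n].
  - assert (Hl : lam <> RtoC 0).
    { intros H; rewrite H, Cmult_0_l in e; apply RtoC_inj in e.
      apply k_neq0, (Rsqr_0_uniq k); unfold Rsqr; lra. }
    rewrite (is_C_derive_unique f lam (2 * lam)%C); [field; exact Hl |].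
    apply (cderive_ext (fun w => w * w - RtoC (k ^ 2))%C); [now intros w |].
    cder; ring.
  - rewrite Hf; field; intros H; apply n, Ceq_minus, H. }
assert (H0 : forall f, (forall w, f w = RtoC 0) -> pole_quotient k f lam = RtoC 0).
{ intros f Hf; unfold pole_quotient.
  destruct (excluded_middle_informative ((lam * lam)%C = RtoC (k ^ 2))).
  - rewrite (is_C_derive_unique f lam (RtoC 0)); [unfold Cdiv; ring |].
    apply (cderive_ext (fun _ => RtoC 0)); [now intros w | apply cderive_const].
  - rewrite Hf; ring. }
unfold new_E.
rewrite (H1 (num_fst 0 0 0)), (H0 (num_snd 0 0 0)), (H0 (num_fst 1 0 0)),
  (H1 (num_snd 1 0 0)); [reflexivity | apply Hnum ..].
Qed.

Lemma new_E_trivialization : is_trivialization Om (bt_q q xit k) new_E.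
Proof.
split; [| split].
- intros x t lam Ho; apply lax_equations_rows; intros i Hi.
  destruct i as [| [| i]]; [| | lia];
    [apply (new_E_rows 0) | apply (new_E_rows 1)]; auto.
- exact new_E_entire.
- exact new_E_at_0.
Qed.

End NewParameter.

Theorem mainTheorem16 (U Om : R * R -> Prop) (q : R -> R -> R)
    (E : R -> R -> C -> Cmx 2 2) (xi k : R)
    (U_open : open U) (U_connected : connected_set U) (U_0 : U (0, 0))
    (q_KdV : KdV_solution U q) (E_triv : is_trivialization U q E)
    (k_neq0 : k <> 0)
    (Om_open : open Om) (Om_0 : Om (0, 0))
    (Om_sub : forall p : R * R, Om p -> U p)
    (f2_neq0 : forall x t : R, Om (x, t) -> bt_f2 E xi k x t <> RtoC 0) :
  exists (xit : R -> R -> R) (Et : R -> R -> C -> Cmx 2 2),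
    (* the quotient defining xit is real *)
    (forall x t : R, Om (x, t) ->
       RtoC (xit x t) = (RtoC k - bt_f1 E xi k x t / bt_f2 E xi k x t)%C) /\
    (* the singularities at lam = k and lam = - k are removable *)
    (forall (x t : R) (lam : C), Om (x, t) ->
       lam <> RtoC k -> lam <> RtoC (- k) ->
       Et x t lam = bt_E E xit xi k x t lam) /\
    KdV_solution Om (bt_q q xit k) /\
    is_trivialization Om (bt_q q xit k) Et.
Proof.
destruct q_KdV as [q_smooth q_eq].
assert (Hf : forall x t, Om (x, t) ->
  bt_f2 E xi k x t = spec_fst E xi k x t /\
  bt_f1 E xi k x t = (- spec_snd E xi k x t)%C).
{ intros x t Ho; apply bt_f_spec, (trivialization_det U q); auto. }
assert (Hneq : forall x t, Om (x, t) -> spec_fst E xi k x t <> RtoC 0).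
{ intros x t Ho; rewrite <- (proj1 (Hf x t Ho)); now apply f2_neq0. }
exists (new_parameter E xi k), (new_E E xi k).
split; [| split; [| split]].
- intros x t Ho; destruct (Hf x t Ho) as [-> ->].
  rewrite (spec_snd_eq U Om q E xi k) by assumption.
  field; now apply Hneq.
- intros x t lam _; apply new_E_eq.
- apply riccati_KdV; [exact Om_open | | |].
  + split; [intros x t Ho; now apply q_smooth, Om_sub
           | intros x t Ho; now apply q_eq, Om_sub].
  + now apply (new_parameter_continuous U Om q).
  + now apply (new_parameter_riccati U Om q).
- now apply (new_E_trivialization U Om q).
Qed.
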